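(* Let $Y_1,Y_2,\dots$ be i.i.d. from a continuous density $f$, with generic observation $Y$. Let $\{f(y,\theta):\theta\in\Theta\}$ be a parametric model with $\Theta\subseteq\mathbb R^p$ open and convex, $\log f(y,\theta)$ concave in $\theta$, and $\theta\mapsto E\log f(Y,\theta)$ having a unique global maximum at $\theta_0$. Suppose $\log f(y,\theta_0+t)-\log f(y,\theta_0)=D(y)'t+R(y,t)$ with $D(Y)$ of mean zero and finite covariance matrix $K$, $E\,R(Y,t)=-\tfrac12t'Jt+o(|t|^2)$ as $t\to0$ for a symmetric positive definite $J$, and $\mathrm{Var}\,R(Y,t)=o(|t|^2)$. Let $\hat\theta_n$ be the maximum likelihood estimator. Let $\pi$ be a (possibly improper) prior density, continuous at $\theta_0$ and satisfying $\pi(\theta)\le C_1\exp(C_2|\theta|)$ for all $\theta$, for positive constants $C_1,C_2$. Let $L_n(\theta)=\prod_{i\le n}f(Y_i,\theta)$ and let $$\theta_n^*=\frac{\int\theta L_n(\theta)\pi(\theta)\,d\theta}{\int L_n(\theta)\pi(\theta)\,d\theta}$$ be the posterior mean. Then $\sqrt n(\theta_n^*-\hat\theta_n)\to_p0$.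
   Context: $\to_p$ denotes convergence in probability. The true density $f$ need not belong to the model.
   Formalization: The formal theorem assumes in addition π(θ₀) > 0, without which the claim fails (e.g. π(θ)=|θ−θ₀| in a normal location model); the observations are real-valued, f(y,θ) > 0 for all y and θ in Θ so that log f is finite, and π is Borel measurable on Θ. *)

(* Defs.v *)
From HB Require Import structures.
From mathcomp Require Import all_boot all_order all_algebra.
From mathcomp Require Import all_classical all_reals all_analysis.

Set Implicit Arguments.
Unset Strict Implicit.
Unset Printing Implicit Defensive.

Import Order.TTheory GRing.Theory Num.Def Num.Theory.
Import numFieldNormedType.Exports.

Local Open Scope classical_set_scope.
Local Open Scope ring_scope.

Section Defs.
Variable R : realType.

Definition enorm p (t : 'rV[R]_p) : R := Num.sqrt (\sum_(i < p) (t ord0 i) ^+ 2).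

Definition quadf p (J : 'M[R]_p) (t : 'rV[R]_p) : R := (t *m J *m t^T) ord0 ord0.

Definition dotr p (u v : 'rV[R]_p) : R := (u *m v^T) ord0 ord0.

Definition convex_setR p (S : set 'rV[R]_p) : Prop :=
  forall a b, S a -> S b -> forall l : R, 0 <= l <= 1 -> S (l *: a + (1 - l) *: b).

Definition concave_on p (S : set 'rV[R]_p) (g : 'rV[R]_p -> R) : Prop :=
  forall a b, S a -> S b -> forall l : R, 0 <= l <= 1 ->
    l * g a + (1 - l) * g b <= g (l *: a + (1 - l) *: b).

Definition rV_borel_on p (D : set 'rV[R]_p) (g : 'rV[R]_p -> R) : Prop :=
  forall B : set R, measurable B -> <<s (@open 'rV[R]_p) >> (D `&` g @^-1` B).

(* Lebesgue integral on R^p, defined as the iterated one-dimensional Lebesgue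
   integral (equal to the integral w.r.t. p-dimensional Lebesgue measure for
   nonnegative or integrable Borel functions, by Tonelli/Fubini). *)
Fixpoint iint (p : nat) : ('rV[R]_p -> \bar R) -> \bar R :=
  match p with
  | 0 => fun g => g 0
  | p'.+1 => fun g =>
      (\int[@lebesgue_measure R]_x
        iint (fun v : 'rV[R]_p' => g (row_mx (\row_(i < 1) x) v)))%E
  end.

Definition remR p (fm : R -> 'rV[R]_p -> R) (D : R -> 'rV[R]_p) (theta0 : 'rV[R]_p)
  (y : R) (t : 'rV[R]_p) : R :=
  ln (fm y (theta0 + t)) - ln (fm y theta0) - dotr (D y) t.

Context {d : measure_display} {Omega : measurableType d}.

Definition mutually_independent (P : probability Omega R) (Y : nat -> Omega -> R) : Prop :=
  forall (I : seq nat) (A : nat -> set R), uniq I -> (forall i, measurable (A i)) ->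
    fine (P (\bigcap_(i in [set` I]) (Y i @^-1` A i))) =
    \prod_(i <- I) fine (P (Y i @^-1` A i)).

(* the events E n hold with (inner) probability tending to one *)
Definition wp_tends_to_one (P : probability Omega R) (E : nat -> set Omega) : Prop :=
  forall eps : R, 0 < eps -> \forall n \near \oo,
    exists A : set Omega, [/\ measurable A, A `<=` E n & ((1 - eps)%:E <= P A)%E].

(* convergence in (outer) probability to 0 of R^p-valued maps *)
Definition cvg_in_prob0 p (P : probability Omega R) (X : nat -> Omega -> 'rV[R]_p) : Prop :=
  forall eps del : R, 0 < eps -> 0 < del -> \forall n \near \oo,
    exists B : set Omega, [/\ measurable B,
      [set w | eps < enorm (X n w)] `<=` B & (P B <= del%:E)%E].

Definition lik p (fm : R -> 'rV[R]_p -> R) (Y : nat -> Omega -> R)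
  (n : nat) (w : Omega) (th : 'rV[R]_p) : R := \prod_(i < n) fm (Y i w) th.

Definition loglik p (fm : R -> 'rV[R]_p -> R) (Y : nat -> Omega -> R)
  (n : nat) (w : Omega) (th : 'rV[R]_p) : R := \sum_(i < n) ln (fm (Y i w) th).

Definition is_mle p (Theta : set 'rV[R]_p) (fm : R -> 'rV[R]_p -> R)
  (Y : nat -> Omega -> R) (n : nat) (w : Omega) (th : 'rV[R]_p) : Prop :=
  Theta th /\ forall th', Theta th' -> loglik fm Y n w th' <= loglik fm Y n w th.

Definition post_den p (Theta : set 'rV[R]_p) (fm : R -> 'rV[R]_p -> R)
  (prior : 'rV[R]_p -> R) (Y : nat -> Omega -> R) (n : nat) (w : Omega) : \bar R :=
  iint (fun th => (\1_Theta th * lik fm Y n w th * prior th)%:E).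

Definition post_num p (Theta : set 'rV[R]_p) (fm : R -> 'rV[R]_p -> R)
  (prior : 'rV[R]_p -> R) (Y : nat -> Omega -> R) (n : nat) (w : Omega)
  (j : 'I_p) : \bar R :=
  iint (fun th => (th ord0 j * (\1_Theta th * lik fm Y n w th * prior th))%:E).

Definition post_absnum p (Theta : set 'rV[R]_p) (fm : R -> 'rV[R]_p -> R)
  (prior : 'rV[R]_p -> R) (Y : nat -> Omega -> R) (n : nat) (w : Omega)
  (j : 'I_p) : \bar R :=
  iint (fun th => (`|th ord0 j| * (\1_Theta th * lik fm Y n w th * prior th))%:E).

Definition post_well_defined p (Theta : set 'rV[R]_p) (fm : R -> 'rV[R]_p -> R)
  (prior : 'rV[R]_p -> R) (Y : nat -> Omega -> R) (n : nat) (w : Omega) : Prop :=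
  (0 < post_den Theta fm prior Y n w < +oo)%E /\
  forall j, (post_absnum Theta fm prior Y n w j < +oo)%E.

Definition post_mean p (Theta : set 'rV[R]_p) (fm : R -> 'rV[R]_p -> R)
  (prior : 'rV[R]_p -> R) (Y : nat -> Omega -> R) (n : nat) (w : Omega) : 'rV[R]_p :=
  \row_j (fine (post_num Theta fm prior Y n w j) / fine (post_den Theta fm prior Y n w)).

End Defs.

(* Main.v *)
(* Write s = sqrt n (theta - theta0), let A(s) be the log-likelihood ratio at theta against
   theta0, and let U be the normalised score. Chebyshev's inequality gives
   A(s) - U.s + s'Js/2 -> 0 in probability for each fixed s. Since A is concave in s, the
   approximation on a fine finite grid already forces it uniformly on compact sets. With
   m = J^-1 U and s = m + u this says that A(m + u) - A(m) is close to -u'Ju/2 for bounded u,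
   and concavity turns the drop on a sphere into a linear decay outside it, which beats the
   exponential growth of the prior. So the maximiser of A is close to m, and the rescaled
   posterior density is uniformly close to exp(-u'Ju/2) with an exponentially decaying
   weight; as u exp(-u'Ju/2) is odd, the posterior mean is close to m as well. *)

(* The integrals over the parameter space are iterated one-dimensional integrals, so linearity,
   positivity and affine substitution are proved by induction on the dimension, for Borel functions
   bounded by [K * expR (- c * l1 u)]. The norm [l1] is chosen because this bound factors over the
   coordinates. Probability and analysis are kept apart. Randomness enters through three events
   only: the score is bounded, the remainder is near its limit at finitely many points, and the
   estimator maximises the likelihood. On their intersection the argument is deterministic, one
   sample at a time. The finite set has to be fixed before [n], so all radii and tolerances are
   uniform over concave functions. The estimator is an arbitrary map, hence events are handled
   through measurable exceptional sets. At [t = s / sqrt n] the errors in mean and variance of the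
   remainder are [o(1 / n)], which a sum of [n] terms tolerates. In the rescaled variable the prior
   grows at rate at most [C2 / sqrt n], eventually below [lam / 8], half of the decay rate [lam / 4]
   that concavity gives the likelihood. *)
Require Import Defs.
From HB Require Import structures.
From mathcomp Require Import all_boot all_order all_algebra.
From mathcomp Require Import all_classical all_reals all_analysis.
From mathcomp Require Import measurable_realfun ring lra.
Set Implicit Arguments.
Unset Strict Implicit.
Unset Printing Implicit Defensive.
Import Order.TTheory GRing.Theory Num.Def Num.Theory.
Import numFieldNormedType.Exports.
Local Open Scope classical_set_scope.
Local Open Scope ring_scope.

(** * Borel functions on row vectors *)

Section borel_rV.
Context {R : realType}.

(** A copy of the row vectors with the Borel sets as measurable sets; it is the generated
    sigma-algebra of [rV_borel_on], so the hypothesis on the prior applies as it stands. *)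
Definition rVB p := g_sigma_algebraType (@open 'rV[R]_p).

(** Cubes with rational centre and radius [1 / (k + 1)] form a countable base, which reduces Borel
    measurability of a map into row vectors to that of its coordinates. *)
Let box p (q : 'rV[rat]_p) (k : nat) : set 'rV[R]_p :=
  [set v | forall i, `|v ord0 i - ratr (q ord0 i)| < k.+1%:R^-1].

Let open_box p (O : set 'rV[R]_p) : open O ->
  O = \bigcup_(z : 'rV[rat]_p * nat) (if `[<box z.1 z.2 `<=` O>] then box z.1 z.2 else set0).
Proof.
move=> oO; apply/seteqP; split; last first.
  move=> v [[q k] _] /=; case: ifPn => // /asboolP; exact.
move=> v Ov; have /nbhs_ballP[e /= e0 He] : nbhs v O by exact: open_nbhs_nbhs.
have [k Hk] : exists k : nat, k.+1%:R^-1 < e / 2.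
  by have := near_infty_natSinv_lt (PosNum (divr_gt0 e0 (ltr0n _ 2))) => -[k _ /(_ k (leqnn k))]; exists k.
have k0 : 0 < k.+1%:R^-1 :> R by rewrite invr_gt0.
have rq (i : 'I_p) : exists q : rat, `|v ord0 i - ratr q| < k.+1%:R^-1.
  have [q] := rat_in_itvoo (ltr_pwDr k0 (lexx (v ord0 i))).
  rewrite in_itv /= => /andP[h1 h2]; exists q.
  by rewrite ltr_norml ltrBDr addrC -ltrBDr opprK h2/= (lt_trans _ k0)// subr_lt0.
have [q Hq] := choice rq.
exists (\row_i q i, k) => //=; rewrite asboolT; first by move=> i; rewrite mxE.
move=> x Hx; apply: He; split => // i j; rewrite (ord1 i) /ball/=.
have := Hx j; have := Hq j; rewrite mxE => h1 h2.
have -> : v ord0 j - x ord0 j = (v ord0 j - ratr (q j)) - (x ord0 j - ratr (q j)) by ring.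
by apply: (le_lt_trans (ler_normB _ _)); rewrite [e]splitr ltrD// (lt_trans _ Hk).
Qed.

Lemma measurable_rVBP d (U : measurableType d) p (c : U -> rVB p) :
  (forall i, measurable_fun setT (fun u => (c u : 'rV[R]_p) ord0 i)) ->
  measurable_fun setT c.
Proof.
move=> mc; apply: (@measurability _ _ U (rVB p) setT c (@open 'rV[R]_p)) => // _ [A oA <-].
rewrite setTI (open_box oA) preimage_bigcup.
apply: countable_bigcupT_measurable; first exact: countableP.
move=> [q k]; case: ifPn => _; last by rewrite preimage_set0.
rewrite [X in measurable X](_ : _ = \bigcap_(i in [set: 'I_p])
   ((fun u => (c u : 'rV[R]_p) ord0 i) @^-1` (ball (ratr (q ord0 i) : R) k.+1%:R^-1))).
  apply: fin_bigcap_measurable => // i _.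
  by rewrite -[X in measurable X]setTI; apply: mc => //; exact: measurable_ball.
apply/seteqP; split=> u /= h i; first by move=> _; rewrite /ball/= distrC; exact: h.
by rewrite distrC; exact: h.
Qed.

Lemma measurable_rVB_open p (O : set (rVB p)) : open (O : set 'rV[R]_p) -> measurable O.
Proof. by move=> oO; apply: sub_sigma_algebra. Qed.

Lemma measurable_rVB_fun p (f : rVB p -> R) :
  (forall a, measurable [set v | a < f v]) -> measurable_fun setT f.
Proof.
move=> mf; apply: (measurability _ (RGenOInfty.measurableE R)) => _ [_ [a ->] <-].
by rewrite setTI preimage_itvoy; exact: mf.
Qed.

Lemma continuous_rVB_measurable p (f : 'rV[R]_p -> R) :
  continuous f -> measurable_fun setT (f : rVB p -> R).
Proof.
move=> cf; apply: measurable_rVB_fun => a; apply: measurable_rVB_open.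
rewrite [X in open X](_ : _ = f @^-1` [set x | a < x]) //.
by apply: open_comp => [x _|]; [exact: cf|exact: open_gt].
Qed.

Lemma measurable_rVB_coord p i : measurable_fun setT (fun v : rVB p => (v : 'rV[R]_p) ord0 i).
Proof. by apply: continuous_rVB_measurable => x; exact: coord_continuous. Qed.

Lemma measurable_row_mx d (U : measurableType d) p (f : U -> R) (g : U -> rVB p) :
  measurable_fun setT f -> measurable_fun setT g ->
  measurable_fun setT (fun u => row_mx (\row_(i < 1) f u) (g u) : rVB p.+1).
Proof.
move=> mf mg; apply: measurable_rVBP => i; case: (@split_ordP 1 p i) => j ->.
  rewrite [X in measurable_fun _ X](_ : _ = f)//.
  apply/funext => u; have := row_mxEl (\row_(k < 1) f u) (g u : 'rV[R]_p) ord0 j.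
  by rewrite [in X in _ = X -> _]mxE.
rewrite [X in measurable_fun _ X](_ : _ = fun u => (g u : 'rV[R]_p) ord0 j).
  exact: (measurableT_comp (measurable_rVB_coord j) mg).
by apply/funext => u; exact: row_mxEr.
Qed.

(** The parameter space [T] is arbitrary because the induction moves the first coordinate from the
    vector into the parameter. Tonelli's theorem then applies to the positive and negative parts
    separately. *)
Lemma measurable_iint p d (T : measurableType d) (g : T * rVB p -> \bar R) :
  measurable_fun setT g -> measurable_fun setT (fun t => iint (fun v => g (t, v))).
Proof.
elim: p d T g => [|p IH] d T g mg /=.
  by apply: (measurableT_comp mg); exact: measurable_fun_pair.
have mh : measurable_fun setT (fun z : (T * measurableTypeR R) * rVB p =>
    (z.1.1, row_mx (\row_(i < 1) z.1.2) z.2 : rVB p.+1)).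
  apply: measurable_fun_pair; first by apply: measurableT_comp.
  by apply: measurable_row_mx => //; exact: measurableT_comp.
have mG := IH _ _ _ (measurableT_comp mg mh).
set G := fun t => _ in mG.
rewrite [X in measurable_fun _ X](_ : _ = fun t =>
   \int[@lebesgue_measure R]_x G^\+ (t, x) - \int[@lebesgue_measure R]_x G^\- (t, x))%E.
  apply: emeasurable_funB.
    by apply: measurable_fun_fubini_tonelli_F => //; exact: measurable_funepos.
  by apply: measurable_fun_fubini_tonelli_F => //; exact: measurable_funeneg.
apply/funext => t; rewrite integralE; congr (_ - _)%E.
  by apply: eq_integral => x _; rewrite !funeposE.
by apply: eq_integral => x _; rewrite !funenegE.
Qed.

End borel_rV.

(** * Affine changes of variable for Lebesgue measure *)

Section lebesgue_affine.
Context {R : realType}.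
Local Notation mu := (@lebesgue_measure R).

(** Lebesgue measure is determined by its values on half-open intervals, so the rescaled pushforward
    is tested there only. A negative [a] swaps the ends and the closed side. *)
Lemma lebesgue_measure_affine (a b : R) (A : set (measurableTypeR R)) : a != 0 -> measurable A ->
  (`|a|%:E * mu ((fun x => (a * x + b)%R) @^-1` A) = mu A)%E.
Proof.
move=> a0 mA.
have mphi : measurable_fun [set: measurableTypeR R] (fun x => a * x + b : measurableTypeR R).
  by apply: measurable_funD => //; exact: measurable_funM.
pose phi : {mfun measurableTypeR R >-> measurableTypeR R} :=
  HB.pack (fun x => a * x + b : measurableTypeR R) (isMeasurableFun.Build _ _ _ _ _ mphi).
have na0 : 0 <= `|a| by [].
apply/esym.
rewrite (@lebesgue_measure_unique R (mscale (NngNum na0) (pushforward mu phi))) //= => _ [[c e] _ <-].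
rewrite /mscale /pushforward /=.
have [/= ltce|lece] := ltP c e; last first.
  by rewrite set_itv_ge ?preimage_set0 ?measure0 ?mule0// bnd_simp -leNgt.
move: a0; rewrite neq_lt => /orP[] a0.
  rewrite [X in (_ * mu X)%E](_ : _ = `[(e - b) / a, (c - b) / a[%classic); last first.
    apply/seteqP; split => x /=; rewrite !in_itv/= ler_ndivrMr// ltr_ndivlMr//;
      rewrite [x * a]mulrC lerBrDr ltrBlDr => /andP[-> ->]//.
  rewrite !lebesgue_measure_itv/= !lte_fin ltce ltr_ndivrMr// divfK ?lt_eqF// ltrD2r ltce.
  by rewrite ltr0_norm// -!EFinB -EFinM; congr EFin; field; rewrite lt_eqF.
rewrite [X in (_ * mu X)%E](_ : _ = `](c - b) / a, (e - b) / a]%classic); last first.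
  apply/seteqP; split => x /=; rewrite !in_itv/= ler_pdivlMr// ltr_pdivrMr//;
    rewrite [x * a]mulrC lerBrDr ltrBlDr => /andP[-> ->]//.
rewrite !lebesgue_measure_itv/= !lte_fin ltce ltr_pdivrMr// divfK ?gt_eqF// ltrD2r ltce.
by rewrite gtr0_norm// -!EFinB -EFinM; congr EFin; field; rewrite gt_eqF.
Qed.

Lemma ge0_integral_affine (f : R -> \bar R) (a b : R) : a != 0 ->
  measurable_fun setT f -> (forall x, 0 <= f x)%E ->
  (\int[mu]_x f (a * x + b)%R = (`|a|^-1)%:E * \int[mu]_x f x)%E.
Proof.
move=> a0 mf f0.
have mphi : measurable_fun [set: measurableTypeR R] (fun x => a * x + b : measurableTypeR R).
  by apply: measurable_funD => //; exact: measurable_funM.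
pose phi : {mfun measurableTypeR R >-> measurableTypeR R} :=
  HB.pack (fun x => a * x + b : measurableTypeR R) (isMeasurableFun.Build _ _ _ _ _ mphi).
have na0 : 0 <= `|a| by [].
rewrite [X in (_ * X)%E](_ : _ = \int[mscale (NngNum na0) (pushforward mu phi)]_x f x)%E.
  rewrite ge0_integral_mscale//= ge0_integral_pushforward//=.
  by rewrite muleA -EFinM mulVf ?normr_eq0// mul1e preimage_setT.
by apply: eq_measure_integral => A mA _; exact/esym/lebesgue_measure_affine.
Qed.

Lemma integrable_affine (f : R -> \bar R) (a b : R) : a != 0 ->
  mu.-integrable setT f -> mu.-integrable setT (fun x => f (a * x + b)).
Proof.
move=> a0 /integrableP[mf fi].
have mphi : measurable_fun [set: measurableTypeR R] (fun x => a * x + b : measurableTypeR R).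
  by apply: measurable_funD => //; exact: measurable_funM.
apply/integrableP; split; first exact: (measurableT_comp mf mphi).
rewrite (ge0_integral_affine (f := fun x => `|f x|%E))//; last exact: measurableT_comp.
by rewrite lte_mul_pinfty// lee_fin invr_ge0.
Qed.

Lemma integral_affine (f : R -> \bar R) (a b : R) : a != 0 ->
  mu.-integrable setT f ->
  (\int[mu]_x f (a * x + b)%R = (`|a|^-1)%:E * \int[mu]_x f x)%E.
Proof.
move=> a0 fi; have mf := measurable_int _ fi.
rewrite [LHS]integralE [in RHS]integralE muleBr//; last first.
  by rewrite fin_num_adde_defl// fin_numN integrable_fin_num//; exact: integrable_funeneg.
have E1 : (\int[mu]_x f^\+ (a * x + b)%R = (`|a|^-1)%:E * \int[mu]_x f^\+ x)%E.
  by apply: ge0_integral_affine => //; exact: measurable_funepos.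
have E2 : (\int[mu]_x f^\- (a * x + b)%R = (`|a|^-1)%:E * \int[mu]_x f^\- x)%E.
  by apply: ge0_integral_affine => //; exact: measurable_funeneg.
rewrite -E1 -E2.
congr (_ - _)%E.
  by apply: eq_integral => x _; rewrite !funeposE.
by apply: eq_integral => x _; rewrite !funenegE.
Qed.

(** The exponential density of rate [c] plus its mirror image, divided by [c], dominates the
    two-sided exponential. *)
Lemma integrable_expR_abs (c : R) : 0 < c ->
  mu.-integrable setT (fun x => (expR (- c * `|x|))%:E).
Proof.
move=> c0; have ip := integrable_exponential_pdf c0.
have N10 : -1 != 0 :> R by rewrite oppr_eq0 oner_eq0.
have ipN := integrable_affine 0 N10 ip.
have : mu.-integrable setT (fun x => (c^-1)%:E * ((exponential_pdf c x)%:E + (exponential_pdf c (-1 * x + 0))%:E))%E.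
  by apply: integrableZl => //; exact: integrableD.
apply: le_integrable => //.
  apply/measurable_EFinP; apply: (measurableT_comp (f := expR)) => //.
  exact: measurable_funM.
move=> x _; rewrite -EFinD -EFinM !abse_EFin lee_fin mulN1r addr0.
rewrite ger0_norm ?expR_ge0// ger0_norm; last first.
  by rewrite mulr_ge0 ?invr_ge0 ?addr_ge0 ?exponential_pdf_ge0// ltW.
rewrite ler_pdivlMl//; have [x0|x0] := leP 0 x.
  by rewrite (ger0_norm x0) (exponential_pdfE _ x0) lerDl exponential_pdf_ge0// ltW.
rewrite (ltr0_norm x0) [in leRHS]addrC exponential_pdfE ?oppr_ge0 ?(ltW x0)//.
by rewrite lerDl exponential_pdf_ge0// ltW.
Qed.

End lebesgue_affine.

(** * The l1 norm and quadratic forms *)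

Section l1_norm.
Context {R : realType}.
Implicit Types p : nat.

(* The l1 norm dominates the Euclidean norm, and is additive over blocks of coordinates. *)
Definition l1 p (u : 'rV[R]_p) : R := \sum_i `|u ord0 i|.

Lemma l1_ge0 p (u : 'rV[R]_p) : 0 <= l1 u.
Proof. exact: sumr_ge0. Qed.

Lemma l1_0 p : l1 (0 : 'rV[R]_p) = 0.
Proof. by rewrite /l1 big1// => i _; rewrite mxE normr0. Qed.

Lemma l1N p (u : 'rV[R]_p) : l1 (- u) = l1 u.
Proof. by apply: eq_bigr => i _; rewrite mxE normrN. Qed.

Lemma l1D p (u v : 'rV[R]_p) : l1 (u + v) <= l1 u + l1 v.
Proof. by rewrite /l1 -big_split; apply: ler_sum => i _; rewrite mxE ler_normD. Qed.

Lemma l1B p (u v : 'rV[R]_p) : l1 (u - v) <= l1 u + l1 v.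
Proof. by rewrite (le_trans (l1D _ _))// l1N. Qed.

Lemma l1Z p (a : R) (u : 'rV[R]_p) : l1 (a *: u) = `|a| * l1 u.
Proof. by rewrite /l1 mulr_sumr; apply: eq_bigr => i _; rewrite mxE normrM. Qed.

Lemma le_coord_l1 p (u : 'rV[R]_p) i : `|u ord0 i| <= l1 u.
Proof. by rewrite /l1 (bigD1 i)//= lerDl sumr_ge0. Qed.

Lemma l1_le p (u : 'rV[R]_p) (e : R) : (forall i, `|u ord0 i| <= e) -> l1 u <= p%:R * e.
Proof.
move=> h; apply: (le_trans (ler_sum _ (fun i _ => h i))).
by rewrite sumr_const card_ord mulr_natl.
Qed.

Lemma enorm_le_l1 p (u : 'rV[R]_p) : enorm u <= l1 u.
Proof.
rewrite /enorm -[leRHS]ger0_norm ?l1_ge0// -sqrtr_sqr ler_sqrt ?sqr_ge0//.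
rewrite expr2 {1}/l1 mulr_suml; apply: ler_sum => i _.
by rewrite -real_normK ?num_real// expr2 ler_wpM2l// le_coord_l1.
Qed.

Lemma enorm_ge0 p (u : 'rV[R]_p) : 0 <= enorm u.
Proof. exact: sqrtr_ge0. Qed.

Lemma nbhs_l1 p (x : 'rV[R]_p) (A : set 'rV[R]_p) : nbhs x A ->
  exists2 e : R, 0 < e & forall y, l1 (y - x) < e -> A y.
Proof.
move=> /nbhs_ballP[e /= e0 He]; exists e => // y hy; apply: He; split => // i j.
rewrite (ord1 i) /ball/= distrC; apply: le_lt_trans hy.
by have := le_coord_l1 (y - x) j; rewrite !mxE.
Qed.

Lemma open_l1 p (A : set 'rV[R]_p) :
  (forall x, A x -> exists2 e : R, 0 < e & forall y, l1 (y - x) < e -> A y) -> open A.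
Proof.
move=> h; rewrite openE => x /h[e e0 He]; apply/nbhs_ballP; exists (e / p.+1%:R) => /=.
  by rewrite divr_gt0.
move=> y [_ hy]; apply: He.
apply: (@le_lt_trans _ _ (p%:R * (e / p.+1%:R))).
  apply: l1_le => i; rewrite !mxE; have := hy ord0 i; rewrite /ball/= distrC => /ltW//.
by rewrite mulrCA gtr_pMr// ltr_pdivrMr// mul1r ltr_nat.
Qed.

(** [quadf J u] is convertible to [bilin J u u], so squares can be expanded by bilinearity. *)
Definition bilin p (J : 'M[R]_p) (u v : 'rV[R]_p) : R := (u *m J *m v^T) ord0 ord0.

Lemma bilinE p (J : 'M[R]_p) u v : bilin J u v = \sum_j \sum_i u ord0 i * J i j * v ord0 j.
Proof.
by rewrite /bilin mxE; apply: eq_bigr => j _; rewrite !mxE mulr_suml.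
Qed.

Lemma bilinDl p (J : 'M[R]_p) u u' v : bilin J (u + u') v = bilin J u v + bilin J u' v.
Proof. by rewrite /bilin !mulmxDl mxE. Qed.

Lemma bilinDr p (J : 'M[R]_p) u v v' : bilin J u (v + v') = bilin J u v + bilin J u v'.
Proof. by rewrite /bilin linearD /= mulmxDr mxE. Qed.

Lemma bilinZl p (J : 'M[R]_p) a u v : bilin J (a *: u) v = a * bilin J u v.
Proof. by rewrite /bilin -!scalemxAl mxE. Qed.

Lemma bilinZr p (J : 'M[R]_p) a u v : bilin J u (a *: v) = a * bilin J u v.
Proof. by rewrite /bilin linearZ /= -scalemxAr mxE. Qed.

Lemma bilinC p (J : 'M[R]_p) u v : J^T = J -> bilin J u v = bilin J v u.
Proof.
move=> Js; rewrite /bilin -[in LHS](trmxK (u *m J *m v^T)) mxE.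
by rewrite trmx_mul trmxK trmx_mul Js mulmxA.
Qed.

Lemma quadfZ p (J : 'M[R]_p) a u : quadf J (a *: u) = a ^+ 2 * quadf J u.
Proof. by rewrite -[LHS]/(bilin J (a *: u) (a *: u)) bilinZl bilinZr mulrA. Qed.

Lemma quadfN p (J : 'M[R]_p) u : quadf J (- u) = quadf J u.
Proof. by rewrite -scaleN1r quadfZ sqrrN expr1n mul1r. Qed.

Lemma quadf0 p (J : 'M[R]_p) : quadf J 0 = 0.
Proof. by rewrite /quadf !mul0mx mxE. Qed.

Definition mxsum p (J : 'M[R]_p) : R := \sum_j \sum_i `|J i j|.

Lemma mxsum_ge0 p (J : 'M[R]_p) : 0 <= mxsum J.
Proof. by apply: sumr_ge0 => j _; apply: sumr_ge0. Qed.

Lemma bilin_le p (J : 'M[R]_p) u v : `|bilin J u v| <= mxsum J * (l1 u * l1 v).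
Proof.
rewrite bilinE /mxsum mulr_suml (le_trans (ler_norm_sum _ _ _))//; apply: ler_sum => j _.
rewrite mulr_suml (le_trans (ler_norm_sum _ _ _))//; apply: ler_sum => i _.
rewrite !normrM [`|_| * `|J i j|]mulrC -mulrA ler_wpM2l//.
by rewrite ler_pM// le_coord_l1.
Qed.

Lemma quadf_lip p (J : 'M[R]_p) (u v : 'rV[R]_p) (M : R) : l1 u <= M -> l1 v <= M ->
  `|quadf J u - quadf J v| <= mxsum J * (2 * M) * l1 (u - v).
Proof.
move=> uM vM.
have -> : quadf J u - quadf J v = bilin J (u - v) u + bilin J v (u - v).
  rewrite -[quadf J u]/(bilin J u u) -[quadf J v]/(bilin J v v).
  by rewrite -(scaleN1r v) bilinDl bilinDr bilinZl bilinZr; ring.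
apply: (le_trans (ler_normD _ _)).
apply: (le_trans (lerD (bilin_le _ _ _) (bilin_le _ _ _))).
rewrite -mulrDr -mulrA ler_wpM2l ?mxsum_ge0// [l1 (u - v) * _]mulrC -mulrDl ler_wpM2r ?l1_ge0//.
lra.
Qed.

Lemma continuous_l1_lip p (f : 'rV[R]_p -> R) :
  (forall M, exists2 K : R, 0 <= K & forall u v, l1 u <= M -> l1 v <= M ->
     `|f u - f v| <= K * l1 (u - v)) -> continuous f.
Proof.
move=> fl x; have [K K0 HK] := fl (l1 x + 1).
apply/(@cvgrPdist_lt _ _ _ (nbhs x) (nbhs_filter x)) => e e0.
have eK : 0 < e / (K + 1) by rewrite divr_gt0// ltr_wpDl.
have : open [set y : 'rV[R]_p | l1 (y - x) < Num.min 1 (e / (K + 1))].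
  apply: open_l1 => y /= hy; exists (Num.min 1 (e / (K + 1)) - l1 (y - x)).
    by rewrite subr_gt0.
  move=> z; rewrite ltrBrDr => hz; apply: le_lt_trans hz.
  by rewrite (_ : z - x = (z - y) + (y - x)) ?l1D// addrA subrK.
rewrite openE => /(_ x); rewrite /= subrr l1_0 lt_min ltr01 eK => /(_ isT).
apply: filterS => y /=; rewrite lt_min => /andP[y1 ye].
apply: (le_lt_trans (HK _ _ _ _)); first by rewrite lerDl.
  by rewrite -[y](subrK x) (le_trans (l1D _ _))// addrC lerD2l ltW.
rewrite -l1N opprB (@le_lt_trans _ _ ((K + 1) * l1 (y - x)))//.
  by rewrite ler_wpM2r ?l1_ge0// lerDl.
by rewrite mulrC -ltr_pdivlMr// ltr_wpDl.
Qed.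

Lemma l1_lip p (u v : 'rV[R]_p) : `|l1 u - l1 v| <= l1 (u - v).
Proof.
rewrite ler_norml; apply/andP; split.
  by rewrite lerNl opprB lerBlDr -(l1N (u - v)) opprB; apply: le_trans (l1D _ _); rewrite subrK.
by rewrite lerBlDr; apply: le_trans (l1D _ _); rewrite subrK.
Qed.

Lemma continuous_l1 p : continuous (@l1 p).
Proof.
by apply: continuous_l1_lip => M; exists 1 => // u v _ _; rewrite mul1r l1_lip.
Qed.

Lemma continuous_quadf p (J : 'M[R]_p) : continuous (quadf J).
Proof.
apply: continuous_l1_lip => M; have [M0|M0] := leP 0 M.
  by exists (mxsum J * (2 * M)) => [|u v]; [rewrite !mulr_ge0// mxsum_ge0|exact: quadf_lip].
by exists 0 => // u v uM _; have := lt_le_trans (le_lt_trans uM M0) (l1_ge0 u); rewrite ltxx.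
Qed.

(** The form attains a positive minimum on the compact [l1] unit sphere, and homogeneity of degree
    two carries the bound to every vector. *)
Lemma quadf_coercive p (J : 'M[R]_p) : (forall t : 'rV[R]_p, t != 0 -> 0 < quadf J t) ->
  exists2 lam : R, 0 < lam & forall u, lam * l1 u ^+ 2 <= quadf J u.
Proof.
move=> Jpos; pose S := [set u : 'rV[R]_p | l1 u = 1].
have l1_eq0 (u : 'rV[R]_p) : l1 u = 0 -> u = 0.
  move=> u0; apply/rowP => i; rewrite mxE; apply/eqP; rewrite -normr_le0 -u0.
  exact: le_coord_l1.
have cS : compact S.
  apply: bounded_closed_compact.
    exists 1; split; first exact: num_real.
    move=> M M1 u /= Su; rewrite [leLHS]/normr/= mx_normrE.
    apply/bigmax_leP; split => [|[i j] _] /=; first by rewrite ltW// (lt_trans _ M1).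
    by rewrite (ord1 i) (le_trans (le_coord_l1 _ _))// Su ltW.
  rewrite [S](_ : _ = @l1 p @^-1` [set 1]); last by apply/seteqP; split.
  by apply: preimage_closed => [x _|]; [exact: continuous_l1|exact: closed_eq].
(* The sphere is empty when there are no coordinates; every [u] is then 0 and any positive constant
   serves. *)
have [S0|/set0P/negP/negPn/eqP S0] := pselect (S !=set0); last first.
  exists 1 => // u; have [u0|u0] := eqVneq u 0; first by rewrite u0 l1_0 quadf0 expr0n mulr0.
  have : S ((l1 u)^-1 *: u).
    rewrite /S /= l1Z ger0_norm ?invr_ge0 ?l1_ge0// mulVf//.
    by apply: contra_neq u0; exact: l1_eq0.
  by rewrite S0.
have [v] := EVT_min_rV S0 cS (continuous_subspaceT (@continuous_quadf p J)).
rewrite inE => Sv Hv; exists (quadf J v).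
  by apply: Jpos; apply/eqP => v0; move: Sv; rewrite v0 /S /= l1_0 => /esym/eqP; rewrite oner_eq0.
move=> u; have [u0|u0] := eqVneq u 0; first by rewrite u0 l1_0 quadf0 expr0n mulr0.
have lu0 : l1 u != 0 by apply: contra_neq u0; exact: l1_eq0.
have := Hv ((l1 u)^-1 *: u); rewrite inE /S /= l1Z ger0_norm ?invr_ge0 ?l1_ge0// mulVf//.
move=> /(_ erefl); rewrite quadfZ exprVn ler_pdivlMl; last by rewrite exprn_gt0// lt_def lu0 l1_ge0.
by rewrite mulrC.
Qed.

End l1_norm.

(** * Iterated integrals of exponentially dominated functions *)

Section iterated_integral.
Context {R : realType}.
Local Notation mu := (@lebesgue_measure R).

Lemma l1_row_mx p (x : R) (v : 'rV[R]_p) : l1 (row_mx (\row_(i < 1) x) v : 'rV[R]_p.+1) = `|x| + l1 v.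
Proof.
have -> : l1 (row_mx (\row_(i < 1) x) v : 'rV[R]_p.+1) =
    \sum_(i < 1 + p) `|row_mx (\row_(i < 1) x) v ord0 i| by [].
rewrite big_split_ord /= big_ord1 row_mxEl mxE; congr (_ + _).
by apply: eq_bigr => i _; rewrite row_mxEr.
Qed.

(** The class in which the integrals are computed. Sections of a member are members with the same
    rate, so each property of the iterated integral follows by induction from the one-dimensional
    case. *)
Definition expdom p (g : 'rV[R]_p -> R) : Prop :=
  measurable_fun setT (g : rVB p -> R) /\
  exists K c : R, 0 < c /\ forall u, `|g u| <= K * expR (- c * l1 u).

(** [fine] sends infinite values to 0; [IintE] shows that nothing is lost on [expdom] functions. *)
Definition Iint p (g : 'rV[R]_p -> R) : R := fine (iint (fun u => (g u)%:E)).

Let V (c : R) : R := fine (\int[mu]_x (expR (- c * `|x|))%:E).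

Lemma iint_ge0 p (g : 'rV[R]_p -> \bar R) : (forall u, 0 <= g u)%E -> (0 <= iint g)%E.
Proof.
by elim: p g => [|p IH] g g0 //=; apply: integral_ge0 => x _; exact: IH.
Qed.

Lemma measurable_section p (g : 'rV[R]_p.+1 -> R) x :
  measurable_fun setT (g : rVB p.+1 -> R) ->
  measurable_fun setT ((fun v => g (row_mx (\row_(i < 1) x) v)) : rVB p -> R).
Proof. by move=> mg; apply: (measurableT_comp mg); exact: measurable_row_mx. Qed.

Lemma measurable_iint_section p (g : 'rV[R]_p.+1 -> R) :
  measurable_fun setT (g : rVB p.+1 -> R) ->
  measurable_fun setT (fun x : R => iint (fun v : 'rV[R]_p => (g (row_mx (\row_(i < 1) x) v))%:E)).
Proof.
move=> mg; apply: (@measurable_iint _ _ _ (measurableTypeR R)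
  (fun z => (g (row_mx (\row_(i < 1) z.1) z.2))%:E)).
by apply/measurable_EFinP; apply: (measurableT_comp mg); exact: measurable_row_mx.
Qed.

(** The dominating function is a product over the coordinates, so every integration contributes one
    factor [V c]. *)
Lemma iint_bound p (g : 'rV[R]_p -> R) (K c : R) : 0 < c ->
  measurable_fun setT (g : rVB p -> R) ->
  (forall u, `|g u| <= K * expR (- c * l1 u)) ->
  (`|iint (fun u => (g u)%:E)| <= (K * V c ^+ p)%:E)%E.
Proof.
move=> c0; have ie := integrable_expR_abs c0.
elim: p g K => [|p IH] g K mg gK /=.
  rewrite lee_fin mulr1; apply: le_trans (gK 0) _.
  by rewrite l1_0 mulr0 expR0 mulr1.
have mI := measurable_iint_section mg.
have K0 : 0 <= K.
  by have := le_trans (normr_ge0 _) (gK 0); rewrite l1_0 mulr0 expR0 mulr1.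
have Vp : 0 <= V c ^+ p.
  by rewrite exprn_ge0// fine_ge0// integral_ge0// => x _; rewrite lee_fin expR_ge0.
apply: le_trans.
  apply: le_abse_integral; [exact: measurableT|exact: mI].
apply: (@le_trans _ _ (\int[mu]_x ((K * V c ^+ p)%:E * (expR (- c * `|x|))%:E))%E).
  apply: ge0_le_integral => //.
  - exact: measurableT_comp.
  - apply: emeasurable_funM => //; exact: measurable_int ie.
  - move=> x _; rewrite -EFinM mulrAC; apply: IH; first exact: measurable_section.
    by move=> v; apply: le_trans (gK _) _; rewrite l1_row_mx mulrDr expRD mulrA.
rewrite integralZl// -[X in (_ * X)%E]fineK; last exact: integrable_fin_num.
by rewrite -EFinM lee_fin exprSr mulrA.
Qed.

Lemma expdom_fin_num p (g : 'rV[R]_p -> R) : expdom g -> iint (fun u => (g u)%:E) \is a fin_num.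
Proof.
move=> [mg [K [c [c0 gK]]]]; rewrite fin_num_abs.
exact: le_lt_trans (iint_bound c0 mg gK) (ltry _).
Qed.

Lemma IintE p (g : 'rV[R]_p -> R) : expdom g -> iint (fun u => (g u)%:E) = (Iint g)%:E.
Proof. by move=> gd; rewrite /Iint fineK//; exact: expdom_fin_num. Qed.

(** One [W] serves all functions of rate [c]: it has to be known before the tolerance [kappa] is
    chosen, hence before the function to be integrated. *)
Lemma Iint_bound p (c : R) : 0 < c -> exists2 W : R, 0 <= W & forall (g : 'rV[R]_p -> R) (K : R),
  measurable_fun setT (g : rVB p -> R) -> (forall u, `|g u| <= K * expR (- c * l1 u)) ->
  `|Iint g| <= K * W.
Proof.
move=> c0; exists (V c ^+ p).
  by rewrite exprn_ge0// fine_ge0// integral_ge0// => x _; rewrite lee_fin expR_ge0.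
move=> g K mg gK; have := iint_bound c0 mg gK; rewrite IintE ?abse_EFin ?lee_fin//.
by split => //; exists K, c.
Qed.

Lemma expdom_section p (g : 'rV[R]_p.+1 -> R) x : expdom g ->
  expdom (fun v : 'rV[R]_p => g (row_mx (\row_(i < 1) x) v)).
Proof.
move=> [mg [K [c [c0 gK]]]]; split; first exact: measurable_section.
exists (K * expR (- c * `|x|)), c; split => // v.
by apply: le_trans (gK _) _; rewrite l1_row_mx mulrDr expRD mulrA.
Qed.

Lemma integrable_iint_section p (g : 'rV[R]_p.+1 -> R) : expdom g ->
  mu.-integrable setT (fun x => iint (fun v : 'rV[R]_p => (g (row_mx (\row_(i < 1) x) v))%:E)).
Proof.
move=> gd; have [mg [K [c [c0 gK]]]] := gd.
have : mu.-integrable setT (fun x => (K * V c ^+ p)%:E * (expR (- c * `|x|))%:E)%E.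
  by apply: integrableZl => //; exact: integrable_expR_abs.
apply: le_integrable => //; first exact: measurable_iint_section.
move=> x _; apply: (@le_trans _ _ ((K * V c ^+ p)%:E * (expR (- c * `|x|))%:E)%E).
  rewrite -EFinM mulrAC; apply: iint_bound => //; first exact: measurable_section.
  by move=> v; apply: le_trans (gK _) _; rewrite l1_row_mx mulrDr expRD mulrA.
by rewrite -EFinM abse_EFin lee_fin ler_norm.
Qed.

Lemma expdomZ p (a : R) (g : 'rV[R]_p -> R) : expdom g -> expdom (fun u => a * g u).
Proof.
move=> [mg [K [c [c0 gK]]]]; split; first exact: measurable_funM.
exists (`|a| * K), c; split => // u; rewrite normrM -mulrA ler_wpM2l//.
Qed.

Lemma expdomD p (g1 g2 : 'rV[R]_p -> R) : expdom g1 -> expdom g2 -> expdom (fun u => g1 u + g2 u).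
Proof.
move=> [mg1 [K1 [c1 [c10 gK1]]]] [mg2 [K2 [c2 [c20 gK2]]]]; split; first exact: measurable_funD.
have K0 (K c : R) (g : 'rV[R]_p -> R) : (forall u, `|g u| <= K * expR (- c * l1 u)) -> 0 <= K.
  by move=> /(_ 0); rewrite l1_0 mulr0 expR0 mulr1; exact: le_trans.
exists (K1 + K2), (Num.min c1 c2); split; first by rewrite lt_min c10.
move=> u; apply: (le_trans (ler_normD _ _)); rewrite mulrDl; apply: lerD.
  apply: (le_trans (gK1 u)); rewrite ler_wpM2l ?(K0 _ _ _ gK1)// ler_expR.
  by rewrite ler_wpM2r ?l1_ge0// lerN2 ge_min lexx.
apply: (le_trans (gK2 u)); rewrite ler_wpM2l ?(K0 _ _ _ gK2)// ler_expR.
by rewrite ler_wpM2r ?l1_ge0// lerN2 ge_min lexx orbT.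
Qed.

Lemma iint_lin p (a : R) (g1 g2 : 'rV[R]_p -> R) : expdom g1 -> expdom g2 ->
  (iint (fun u => (a * g1 u + g2 u)%:E) =
   a%:E * iint (fun u => (g1 u)%:E) + iint (fun u => (g2 u)%:E))%E.
Proof.
elim: p g1 g2 => [|p IH] g1 g2 d1 d2 //=.
under eq_integral do rewrite (IH _ _ (expdom_section _ d1) (expdom_section _ d2)).
have i1 := integrable_iint_section d1; have i2 := integrable_iint_section d2.
rewrite integralD//; last exact: integrableZl.
by rewrite integralZl.
Qed.

Lemma Iint_lin p (a : R) (g1 g2 : 'rV[R]_p -> R) : expdom g1 -> expdom g2 ->
  Iint (fun u => a * g1 u + g2 u) = a * Iint g1 + Iint g2.
Proof. by move=> d1 d2; rewrite /Iint iint_lin// !IintE// -EFinM -EFinD. Qed.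

Lemma expdom0 p : expdom (fun _ : 'rV[R]_p => 0).
Proof. by split => //; exists 0, 1; split => // u; rewrite normr0 mul0r. Qed.

Lemma IintZ p (a : R) (g : 'rV[R]_p -> R) : expdom g -> Iint (fun u => a * g u) = a * Iint g.
Proof.
move=> d; have z : Iint (fun _ : 'rV[R]_p => 0) = 0.
  have := Iint_lin 1 (expdom0 p) (expdom0 p).
  under [in X in Iint X = _]eq_fun do rewrite mulr0 addr0.
  by rewrite mul1r => /esym/eqP; rewrite -subr_eq0 addrK => /eqP.
have := Iint_lin a d (expdom0 p); rewrite z addr0 => <-.
by congr Iint; apply/funext => u; rewrite addr0.
Qed.

(** If the outer integral vanished, the inner integrals, positive everywhere by induction, would be
    0 almost everywhere; the exceptional null set would then contain [[0, 1]]. *)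
Lemma Iint_gt0 p (g : 'rV[R]_p -> R) : expdom g -> (forall u, 0 < g u) -> 0 < Iint g.
Proof.
elim: p g => [|p IH] g gd g0; first exact: g0.
have ig := integrable_iint_section gd.
have I0 x : (0 < iint (fun v : 'rV[R]_p => (g (row_mx (\row_(i < 1) x) v))%:E))%E.
  by rewrite IintE ?lte_fin; [apply: IH|]; rewrite //; exact: expdom_section.
rewrite lt_def; apply/andP; split; last first.
  by rewrite /Iint fine_ge0// iint_ge0// => u; rewrite lee_fin ltW.
apply/eqP => Iz.
have : (\int[mu]_x `|iint (fun v : 'rV[R]_p => (g (row_mx (\row_(i < 1) x) v))%:E)| = 0)%E.
  under eq_integral do rewrite gee0_abs ?(ltW (I0 _))//.
  by have := IintE gd; rewrite Iz.
move=> /(ae_eq_integral_abs mu measurableT (measurable_int _ ig)) [A [mA A0 HA]].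
have : (mu `[0%R, 1%R]%classic <= mu A)%E.
  apply: le_measure; rewrite ?inE// => x _; apply: HA => /= /(_ I) xz.
  by have := I0 x; rewrite xz ltxx.
by rewrite A0 lebesgue_measure_itv/= lte_fin ltr01 oppr0 adde0 lee_fin ler10.
Qed.

Lemma measurable_rVB_affine p (a : R) (b : 'rV[R]_p) :
  measurable_fun setT ((fun u => a *: (u : 'rV[R]_p) + b) : rVB p -> rVB p).
Proof.
apply: measurable_rVBP => i.
rewrite [X in measurable_fun _ X](_ : _ = fun u : rVB p => a * (u : 'rV[R]_p) ord0 i + b ord0 i).
  by apply: measurable_funD => //; apply: measurable_funM => //; exact: measurable_rVB_coord.
by apply/funext => u; rewrite !mxE.
Qed.

Lemma expdom_affine p (a : R) (b : 'rV[R]_p) (g : 'rV[R]_p -> R) : a != 0 -> expdom g ->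
  expdom (fun u => g (a *: u + b)).
Proof.
move=> a0 [mg [K [c [c0 gK]]]]; split; first exact: (measurableT_comp mg (measurable_rVB_affine a b)).
have K0 : 0 <= K by have := le_trans (normr_ge0 _) (gK 0); rewrite l1_0 mulr0 expR0 mulr1.
exists (K * expR (c * l1 b)), (c * `|a|); split; first by rewrite mulr_gt0// normr_gt0.
move=> u; apply: (le_trans (gK _)); rewrite -mulrA ler_wpM2l// -expRD ler_expR.
have : l1 (a *: u) <= l1 (a *: u + b) + l1 b.
  by apply: le_trans (l1B _ _); rewrite addrK.
by rewrite l1Z => h; have := ler_wpM2l (ltW c0) h; lra.
Qed.

(** A dilation by one scalar followed by a translation acts on each coordinate separately, so the
    one-dimensional substitution gives a factor [|a|^-1] per coordinate. *)
Lemma iint_affine p (a : R) (b : 'rV[R]_p) (g : 'rV[R]_p -> R) : a != 0 -> expdom g ->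
  (iint (fun u => (g (a *: u + b))%:E) = (`|a|^-1 ^+ p)%:E * iint (fun u => (g u)%:E))%E.
Proof.
move=> a0; elim: p b g => [|p IH] b g gd /=.
  by rewrite mul1e; congr (g _)%:E; apply/rowP => -[].
pose b0 := (b : 'rV[R]_(1 + p)) ord0 (lshift p ord0).
pose b1 := rsubmx (b : 'rV[R]_(1 + p)).
have bE (x : R) (v : 'rV[R]_p) : a *: (row_mx (\row_(i < 1) x) v : 'rV[R]_p.+1) + b =
    row_mx (\row_(i < 1) (a * x + b0)) (a *: v + b1).
  apply/rowP => i; case: (@split_ordP 1 p i) => j ->.
    rewrite -[RHS]/((row_mx (\row_(i < 1) (a * x + b0)) (a *: v + b1)) ord0 (lshift p j)).
    rewrite row_mxEl [LHS]mxE [X in X + _]mxE.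
    rewrite -[X in _ * X + _ = _]/((row_mx (\row_(i < 1) x) v) ord0 (lshift p j)) row_mxEl !mxE.
    by rewrite /b0 (ord1 j).
  rewrite -[RHS]/((row_mx (\row_(i < 1) (a * x + b0)) (a *: v + b1)) ord0 (rshift 1 j)).
  rewrite row_mxEr [LHS]mxE [X in X + _]mxE.
  rewrite -[X in _ * X + _ = _]/((row_mx (\row_(i < 1) x) v) ord0 (rshift 1 j)) row_mxEr.
  by rewrite [RHS]mxE [X in _ = X + _]mxE; congr (_ + _); rewrite mxE.
under eq_integral => x _.
  under eq_fun => v do rewrite bE.
  rewrite (IH b1 _ (expdom_section _ gd)).
  over.
have ig := integrable_iint_section gd.
rewrite integralZl//; last exact: (integrable_affine b0 a0 ig).
rewrite (integral_affine b0 a0 ig) muleA -EFinM.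
by congr ((_)%:E * _)%E; rewrite exprSr.
Qed.

Lemma Iint_affine p (a : R) (b : 'rV[R]_p) (g : 'rV[R]_p -> R) : a != 0 -> expdom g ->
  Iint (fun u => g (a *: u + b)) = `|a|^-1 ^+ p * Iint g.
Proof. by move=> a0 gd; rewrite /Iint iint_affine// IintE. Qed.

Lemma Iint_odd p (g : 'rV[R]_p -> R) : expdom g -> (forall u, g (- u) = - g u) -> Iint g = 0.
Proof.
move=> gd go; have N10 : -1 != 0 :> R by rewrite oppr_eq0 oner_eq0.
have := Iint_affine 0 N10 gd; rewrite normrN1 invr1 expr1n mul1r.
under [in X in Iint X = _]eq_fun do rewrite addr0 scaleN1r go -mulN1r.
by rewrite IintZ// mulN1r => /eqP; rewrite eqNr => /eqP.
Qed.

End iterated_integral.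

(** * Concave functions *)

Section concave.
Context {R : realType}.

(** A concave function on a box is smallest at a vertex. Coordinates are pushed to the ends one at a
    time, each point being a convex combination of its two pushed copies. *)
Lemma concave_box p (S : set 'rV[R]_p) (k : 'rV[R]_p -> R) (a b s : 'rV[R]_p) (c : R) :
  concave_on S k ->
  (forall v : 'rV[R]_p, (forall i, a ord0 i <= v ord0 i <= b ord0 i) -> S v) ->
  (forall i, a ord0 i <= b ord0 i) ->
  (forall v : 'rV[R]_p, (forall i, v ord0 i = a ord0 i \/ v ord0 i = b ord0 i) -> c <= k v) ->
  (forall i, a ord0 i <= s ord0 i <= b ord0 i) -> c <= k s.
Proof.
move=> ck Sbox ab kv sab.
(* [m] counts the leading coordinates that may still lie strictly inside their sides. *)
suff H m (v : 'rV[R]_p) : (forall i : 'I_p, a ord0 i <= v ord0 i <= b ord0 i) ->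
    (forall i : 'I_p, (m <= i)%N -> v ord0 i = a ord0 i \/ v ord0 i = b ord0 i) -> c <= k v.
  by apply: (H p) => // i; rewrite leqNgt ltn_ord.
elim: m v => [|m IH] v vab vm; first by apply: kv => i; exact: vm.
have [pm|mp] := leqP p m.
  by apply: IH => // i mi; have := leq_ltn_trans (leq_trans pm mi) (ltn_ord i); rewrite ltnn.
pose im := Ordinal mp.
have [abm|] := ltP (a ord0 im) (b ord0 im); last first.
  move=> bam; apply: IH => // i; rewrite leq_eqVlt => /orP[/eqP mi|]; last exact: vm.
  have -> : i = im by exact/val_inj.
  left; apply/eqP; rewrite eq_le; have /andP[-> vb] := vab im.
  by rewrite (le_trans vb bam).
pose upd x : 'rV[R]_p := \row_i (if i == im then x else v ord0 i).
have updab x : a ord0 im <= x <= b ord0 im -> forall i, a ord0 i <= upd x ord0 i <= b ord0 i.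
  by move=> xab i; rewrite mxE; case: eqP => [->|_].
have updm x : (x = a ord0 im \/ x = b ord0 im) ->
    forall i : 'I_p, (m <= i)%N -> upd x ord0 i = a ord0 i \/ upd x ord0 i = b ord0 i.
  move=> xab i; rewrite leq_eqVlt mxE => /orP[/eqP mi|mi].
    by have -> : i = im by [exact/val_inj]; rewrite eqxx.
  by case: eqP => [->//|_]; exact: vm.
have ka : c <= k (upd (a ord0 im)) by apply: IH; [apply: updab; rewrite lexx ltW|apply: updm; left].
have kb : c <= k (upd (b ord0 im)) by apply: IH; [apply: updab; rewrite lexx ltW|apply: updm; right].
pose l := (b ord0 im - v ord0 im) / (b ord0 im - a ord0 im).
have bap : 0 < b ord0 im - a ord0 im by rewrite subr_gt0.
have /andP[avm vbm] := vab im.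
have l01 : 0 <= l <= 1.
  apply/andP; split; first by rewrite divr_ge0// ?subr_ge0// ltW.
  by rewrite /l ler_pdivrMr// mul1r lerD2l lerN2.
have -> : v = l *: upd (a ord0 im) + (1 - l) *: upd (b ord0 im).
  apply/rowP => i; rewrite !mxE; case: eqP => [->|_]; last by ring.
  by rewrite /l; field; rewrite gt_eqF.
have := ck _ _ (Sbox _ (updab _ _)) (Sbox _ (updab _ _)) _ l01.
move=> /(_ (a ord0 im) (b ord0 im)) H.
have H' := H ltac:(by rewrite lexx ltW) ltac:(by rewrite lexx ltW).
apply: le_trans H'.
have /andP[l0 l1'] := l01.
have := ler_wpM2l l0 ka; have l1'' : 0 <= 1 - l by rewrite subr_ge0.
have := ler_wpM2l l1'' kb; lra.
Qed.

(** [x] is the midpoint of [y] and its mirror image, so a lower bound at the mirror image becomes an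
    upper bound at [y]. *)
Lemma concave_reflect p (S : set 'rV[R]_p) (k : 'rV[R]_p -> R) (x y : 'rV[R]_p) :
  concave_on S k -> S y -> S (x + (x - y)) -> k y + k (x + (x - y)) <= 2 * k x.
Proof.
move=> ck Sy Sy'; have h : 0 <= (2^-1 : R) <= 1 by apply/andP; split; lra.
have := ck _ _ Sy Sy' _ h.
have -> : 2^-1 *: y + (1 - 2^-1) *: (x + (x - y)) = x.
  by apply/rowP => i; rewrite !mxE; lra.
by move=> H; lra.
Qed.

(** The vertices of a small cube bound [k] below on the cube by [c]. Contracting the cube towards
    [x] by [r] reduces the possible drop to [r * (k x - c)], and reflection through [x] bounds the
    rise by the same amount. *)
Lemma concave_continuous p (S : set 'rV[R]_p) (k : 'rV[R]_p -> R) (x : 'rV[R]_p) (e : R) :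
  open S -> concave_on S k -> S x -> 0 < e ->
  exists2 del : R, 0 < del & forall y, l1 (y - x) < del -> S y /\ `|k y - k x| < e.
Proof.
move=> oS ck Sx e0.
have [rho rho0 Hrho] : exists2 e : R, 0 < e & forall y, l1 (y - x) < e -> S y.
  by apply: nbhs_l1; exact: open_nbhs_nbhs.
pose tau := rho / p.+1%:R; have tau0 : 0 < tau by rewrite divr_gt0.
have ptau : p%:R * tau < rho by rewrite mulrCA gtr_pMr// ltr_pdivrMr// mul1r ltr_nat.
have Sbox (y : 'rV[R]_p) : (forall i, `|y ord0 i - x ord0 i| <= tau) -> S y.
  move=> h; apply: Hrho; apply: le_lt_trans ptau; apply: l1_le => i.
  by rewrite !mxE.
pose vtx (f : {ffun 'I_p -> bool}) : 'rV[R]_p :=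
  \row_i (if f i then x ord0 i + tau else x ord0 i - tau).
pose c := - \sum_f `|k (vtx f)|.
have cbox (y : 'rV[R]_p) : (forall i, `|y ord0 i - x ord0 i| <= tau) -> c <= k y.
  move=> yb.
  apply: (@concave_box _ S k (\row_i (x ord0 i - tau)) (\row_i (x ord0 i + tau))) => //.
  - move=> v vb; apply: Sbox => i; have := vb i; rewrite !mxE ler_norml => /andP[h1 h2].
    by apply/andP; split; lra.
  - by move=> i; rewrite !mxE; lra.
  - move=> v hv; pose f := [ffun i => v ord0 i == x ord0 i + tau].
    have -> : v = vtx f.
      apply/rowP => i; rewrite !mxE ffunE; have := hv i; rewrite !mxE.
      by case: eqP => [->//|ne [->//|/ne]].
    rewrite /c lerNl (le_trans _ (_ : `|k (vtx f)| <= _))//; first by rewrite lerNl lerNnormlW.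
    by rewrite (bigD1 f)//= lerDl sumr_ge0.
  - move=> i; have := yb i; rewrite !mxE ler_norml => /andP[h1 h2].
    by apply/andP; split; lra.
have cx : c <= k x by apply: cbox => i; rewrite subrr normr0 ltW.
pose C := k x - c; have C0 : 0 <= C by rewrite subr_ge0.
pose r := Num.min 1 (e / (C + 1)).
have C1 : 0 < C + 1 by rewrite ltr_wpDl.
have r0 : 0 < r by rewrite /r lt_min ltr01 divr_gt0.
have r1 : r <= 1 by rewrite /r ge_min lexx.
have rC : r * C < e.
  have : r <= e / (C + 1) by rewrite /r ge_min lexx orbT.
  rewrite ler_pdivlMr// => h; apply: lt_le_trans h; rewrite ltr_pM2l//; lra.
have low (y : 'rV[R]_p) : l1 (y - x) < r * tau -> S y /\ k x - r * C <= k y.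
  move=> hy.
  have yi i : `|y ord0 i - x ord0 i| <= r * tau.
    by apply: le_trans (ltW hy); have := le_coord_l1 (y - x) i; rewrite !mxE.
  have rt : r * tau <= tau by rewrite ger_pMl.
  have Sy : S y by apply: Sbox => i; exact: le_trans (yi i) rt.
  (* [z] is [y] blown up from [x] by [1 / r]; it stays in the cube, and [y] lies between [z] and
     [x]. *)
  split => //; pose z := x + r^-1 *: (y - x).
  have zi i : `|z ord0 i - x ord0 i| <= tau.
    have rV0 : 0 <= r^-1 by rewrite invr_ge0 ltW.
    by rewrite !mxE addrC addKr normrM (ger0_norm rV0) ler_pdivrMl.
  have h : 0 <= r <= 1 by rewrite r1 ltW.
  have := ck _ _ (Sbox _ zi) Sx _ h.
  have -> : r *: z + (1 - r) *: x = y.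
    by apply/rowP => i; rewrite !mxE; field; rewrite gt_eqF.
  have := ler_wpM2l (ltW r0) (cbox _ zi); rewrite /C; lra.
exists (r * tau); first exact: mulr_gt0.
move=> y hy; have [Sy ky] := low _ hy; split => //.
have hy' : l1 (x + (x - y) - x) < r * tau by rewrite addrC addKr -l1N opprB.
have [Sy' ky'] := low _ hy'.
have := concave_reflect ck Sy Sy'.
by move=> h; rewrite ltr_norml; apply/andP; split; lra.
Qed.

(** The grid consists of the [2K + 1] points [tau * (j - K)]. The margin of one step in [K - 1]
    makes the right end [j.+1] of the cell a grid index too. *)
Let grid_cell (tau : R) (K : nat) (x : R) : 0 < tau -> `|x| <= tau * (K%:R - 1) ->
  exists j : nat, (j.+1 < K.*2.+1)%N /\
    tau * j%:R - tau * K%:R <= x <= tau * j.+1%:R - tau * K%:R.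
Proof.
move=> t0; rewrite ler_norml => /andP[h1 h2].
have y0 : 0 <= (x + tau * K%:R) / tau by rewrite divr_ge0 ?(ltW t0)//; lra.
have := Num.Theory.truncn_itv y0; set j := Num.truncn _ => /andP[].
rewrite ler_pdivlMr// ltr_pdivrMr// ![_ * tau]mulrC => j1 j2.
exists j; split; last by apply/andP; split; lra.
rewrite ltnS -(ltr_nat R) -(ltr_pM2l t0).
apply: (le_lt_trans j1); rewrite -muln2 natrM; lra.
Qed.

(** [F], [del] and [M2] depend on [J], [M] and [eta] only, not on [k]. Convergence in probability at
    the fixed points of [F] therefore controls the random concave function on the whole ball. *)
Lemma grid_uniform p (J : 'M[R]_p) (M eta : R) : 0 <= M -> 0 < eta ->
  exists (F : seq 'rV[R]_p) (del M2 : R), [/\ 0 < del, M <= M2,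
    (forall v, v \in F -> l1 v <= M2) &
    forall S k, (forall s, l1 s <= M2 -> S s) -> concave_on S k ->
      (forall v, v \in F -> `|k v + 2^-1 * quadf J v| <= del) ->
      forall s, l1 s <= M -> `|k s + 2^-1 * quadf J s| <= eta].
Proof.
(* The lower bound loses [2 * del], and the upper bound obtained by reflection at most [6 * del]. *)
move=> M0 eta0; pose del := eta / 7; have del0 : 0 < del by rewrite divr_gt0.
(* A Lipschitz constant of half the form on the ball of radius [M + 2]: reflection moves a point
   from radius [M] to at most [M + 1], and passing to a vertex of its cell to at most [M + 2]. *)
pose L := mxsum J * (M + 2); have L0 : 0 <= L by rewrite mulr_ge0 ?mxsum_ge0//; lra.
have Lq (u v : 'rV[R]_p) : l1 u <= M + 2 -> l1 v <= M + 2 ->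
    `|2^-1 * quadf J u - 2^-1 * quadf J v| <= L * l1 (u - v).
  move=> uM vM; rewrite -mulrBr normrM ger0_norm; last lra.
  rewrite ler_pdivrMl; last lra.
  by apply: (le_trans (quadf_lip J uM vM)); rewrite /L; lra.
pose mn := Num.min 1 del; have mn0 : 0 < mn by rewrite lt_min ltr01.
(* The mesh is such that a displacement of [2 * p * tau] is at most 1 and changes half the form by
   at most [del]. *)
pose tau := mn / (2 * p.+1%:R * (L + 1)).
have den0 : 0 < 2 * p.+1%:R * (L + 1) by rewrite !mulr_gt0//; lra.
have tau0 : 0 < tau by rewrite divr_gt0.
have ptau0 : 0 <= p%:R * tau by rewrite mulr_ge0// ltW.
have ptau : 2 * (p%:R * tau) * (L + 1) <= mn.
  rewrite [leRHS](_ : _ = 2 * (p.+1%:R * tau) * (L + 1)); last first.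
    rewrite (_ : 2 * _ * _ = tau * (2 * p.+1%:R * (L + 1))); last by ring.
    by rewrite divfK// gt_eqF.
  rewrite ler_wpM2r//; first lra.
  by rewrite ler_wpM2l// ler_wpM2r ?(ltW tau0)// ler_nat.
have pt1 : 2 * (p%:R * tau) <= 1.
  have : mn <= 1 by rewrite ge_min lexx.
  move=> h; have : 0 <= (p%:R * tau) * L by rewrite mulr_ge0.
  lra.
have ptd : L * (2 * (p%:R * tau)) <= del.
  have : mn <= del by rewrite ge_min lexx orbT.
  by move=> h; lra.
have [K HK] : exists K : nat, (M + 2) / tau + 1 <= K%:R.
  exists (Num.truncn ((M + 2) / tau + 1)).+1; by apply: ltW; rewrite Num.Theory.truncnS_gt.
have HK' : M + 2 <= tau * (K%:R - 1) by rewrite -ler_pdivrMl// mulrC; lra.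
pose gp (z : {ffun 'I_p -> 'I_(K.*2.+1)}) : 'rV[R]_p :=
  \row_i (tau * (z i)%:R - tau * K%:R).
pose F := [seq gp z | z : {ffun 'I_p -> 'I_(K.*2.+1)}].
have inF (v : 'rV[R]_p) : (forall i, exists j : nat, (j < K.*2.+1)%N /\ v ord0 i = tau * j%:R - tau * K%:R) -> v \in F.
  move=> /choice[z Hz].
  have -> : v = gp [ffun i => Ordinal (Hz i).1].
    by apply/rowP => i; rewrite mxE ffunE; exact: (Hz i).2.
  by apply: map_f; rewrite mem_enum.
have sF0 : 0 <= \sum_(v <- F) l1 v by apply: sumr_ge0 => v _; exact: l1_ge0.
(* Corners of the grid may lie outside the ball of radius [M + 2]; adding all their norms is a crude
   radius that contains them. *)
exists F, del, (M + 2 + \sum_(v <- F) l1 v); split => //; first lra.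
  move=> v vF; rewrite (big_rem v)//=.
  have : 0 <= \sum_(y <- rem v F) l1 y by apply: sumr_ge0 => w _; exact: l1_ge0.
  lra.
move=> S k SM ck kF.
have cell (s : 'rV[R]_p) : l1 s <= M + 1 -> exists a : 'rV[R]_p, forall i,
   a ord0 i <= s ord0 i <= a ord0 i + tau /\
   exists j : nat, (j.+1 < K.*2.+1)%N /\ a ord0 i = tau * j%:R - tau * K%:R.
  move=> sM.
  have h i : exists j : nat, (j.+1 < K.*2.+1)%N /\
      tau * j%:R - tau * K%:R <= s ord0 i <= tau * j.+1%:R - tau * K%:R.
    apply: grid_cell => //; apply: le_trans HK'; apply: (le_trans (le_coord_l1 s i)); lra.
  have [z Hz] := choice h.
  exists (\row_i (tau * (z i)%:R - tau * K%:R)) => i; rewrite mxE; split.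
    by have := (Hz i).2; rewrite -natr1 => /andP[? ?]; apply/andP; split; lra.
  by exists (z i); split => //; exact: (Hz i).1.
have near (v s : 'rV[R]_p) : (forall i, `|v ord0 i - s ord0 i| <= tau) -> l1 (v - s) <= p%:R * tau.
  by move=> h; apply: l1_le => i; rewrite !mxE.
have l1n (u v : 'rV[R]_p) e : l1 (u - v) <= e -> l1 u <= l1 v + e.
  by move=> h; rewrite -[u](subrK v) addrC (le_trans (l1D _ _))// lerD2l.
(* A lower bound at s comes from the vertices of its grid cell; reflecting s through a
   vertex turns such lower bounds into an upper bound. *)
have low s : l1 s <= M + 1 -> - (2^-1 * quadf J s) - 2 * del <= k s.
  move=> sM; have [a Ha] := cell _ sM.
  have box (v : 'rV[R]_p) : (forall i, a ord0 i <= v ord0 i <= (\row_i (a ord0 i + tau) : 'rV[R]_p) ord0 i) ->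
      l1 (v - s) <= p%:R * tau /\ l1 v <= M + 2.
    move=> hv; have h : l1 (v - s) <= p%:R * tau.
      apply: near => i; have := hv i; rewrite mxE => /andP[h1 h2].
      have [/andP[h3 h4] _] := Ha i; rewrite ler_norml; apply/andP; split; lra.
    by split => //; have := l1n _ _ _ h; lra.
  apply: (@concave_box _ S k a (\row_i (a ord0 i + tau))) => //.
  - by move=> v /box[_ h]; apply: SM; lra.
  - by move=> i; rewrite mxE; lra.
  - move=> v hv.
    have [h1 h2] : l1 (v - s) <= p%:R * tau /\ l1 v <= M + 2.
      by apply: box => i; have := hv i; rewrite mxE => -[->|->]; apply/andP; split; lra.
    have : v \in F.
      apply: inF => i; have [_ [j [jK aj]]] := Ha i; have := hv i; rewrite mxE => -[->|->].
        by exists j; split => //; exact: ltnW.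
      by exists j.+1; split => //; rewrite aj -natr1; ring.
    move=> /kF; rewrite ler_norml => /andP[h3 _].
    have sM2 : l1 s <= M + 2 by lra.
    have := Lq _ _ h2 sM2; have : L * l1 (v - s) <= L * (2 * (p%:R * tau)).
      by rewrite ler_wpM2l//; lra.
    by move=> h4; rewrite ler_norml => /andP[h5 h6]; lra.
  - by move=> i; rewrite mxE; exact: (Ha i).1.
move=> s sM.
have sM1 : l1 s <= M + 1 by lra.
rewrite ler_norml; apply/andP; split; first by have := low _ sM1; rewrite /del; lra.
have [a Ha] := cell _ sM1.
have as' : l1 (a - s) <= p%:R * tau.
  by apply: near => i; have [/andP[h3 h4] _] := Ha i; rewrite ler_norml; apply/andP; split; lra.
have aM : l1 a <= M + 2 by have := l1n _ _ _ as'; lra.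
pose s' := a + (a - s).
have ss' : l1 (s' - s) <= 2 * (p%:R * tau).
  rewrite (_ : s' - s = 2 *: (a - s)); last by apply/rowP => i; rewrite !mxE; ring.
  by rewrite l1Z ger0_norm//; lra.
have s'M : l1 s' <= M + 1 by have := l1n _ _ _ ss'; lra.
have Ss : S s by apply: SM; lra.
have Ss' : S s' by apply: SM; lra.
have := concave_reflect ck Ss Ss'; have := low _ s'M.
have aF : a \in F.
  by apply: inF => i; have [_ [j [jK aj]]] := Ha i; exists j; split => //; exact: ltnW.
have := kF _ aF; rewrite ler_norml => /andP[_ h3].
have sM2 : l1 s <= M + 2 by lra.
have s'M2 : l1 s' <= M + 2 by lra.
have := Lq _ _ aM sM2; have : L * l1 (a - s) <= L * (2 * (p%:R * tau)) by rewrite ler_wpM2l//; lra.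
move=> h4; rewrite ler_norml => /andP[h5 h6].
have := Lq _ _ s'M2 sM2; have : L * l1 (s' - s) <= L * (2 * (p%:R * tau)) by rewrite ler_wpM2l//; lra.
move=> h7; rewrite ler_norml => /andP[h8 h9] h10 h11.
rewrite -/s' in h11; rewrite /del in h3 ptd h10; lra.
Qed.

(** * Consequences of a quadratic expansion for concave functions *)

Section expansion.
Variables (p : nat) (J : 'M[R]_p) (lam : R).
Hypothesis lam0 : 0 < lam.
Hypothesis Jlam : forall u, lam * l1 u ^+ 2 <= quadf J u.

(** If [u] were outside the ball, concavity on the segment from 0 to [u] would give
    [h v >= h 0 >= - eta] at the point [v] of norm [r], while the expansion gives
    [h v <= eta - lam * r ^+ 2 / 2]. *)
Lemma concave_argmax_close (S : set 'rV[R]_p) (h : 'rV[R]_p -> R) (r eta : R) u : 0 < r ->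
  concave_on S h -> (forall v, l1 v <= r -> S v) ->
  (forall v, l1 v <= r -> `|h v + 2^-1 * quadf J v| <= eta) ->
  eta <= lam * r ^+ 2 / 8 -> S u -> h 0 <= h u -> l1 u <= r.
Proof.
move=> r0 ch Sr hr etar Su h0u; rewrite leNgt; apply/negP => ru.
have Lu0 : 0 < l1 u by exact: lt_trans ru.
have l01 : 0 <= r / l1 u <= 1.
  by rewrite divr_ge0 ?(ltW r0) ?l1_ge0//= ler_pdivrMr// mul1r ltW.
have S0 : S 0 by apply: Sr; rewrite l1_0 ltW.
have := ch _ _ Su S0 _ l01; rewrite scaler0 addr0.
set v := _ *: u.
have lv : l1 v = r by rewrite l1Z ger0_norm ?(andP l01).1// divfK ?gt_eqF.
have : l1 v <= r by rewrite lv.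
move=> /hr; rewrite ler_norml => /andP[_ h1].
have : `|h 0 + 2^-1 * quadf J 0| <= eta by apply: hr; rewrite l1_0 ltW.
rewrite quadf0 mulr0 addr0 ler_norml => /andP[h2 _].
have := Jlam v; rewrite lv => h3.
have /andP[l0 _] := l01; have := ler_wpM2l l0 h0u.
have : 0 < lam * r ^+ 2 by rewrite mulr_gt0// exprn_gt0.
lra.
Qed.

(** On the unit sphere [h] is at most [- 3 * lam / 8], and [h 0] is at least [- lam / 8]. Concavity
    along the ray through [u] extrapolates this drop linearly. *)
Lemma concave_tail (S : set 'rV[R]_p) (h : 'rV[R]_p -> R) (eta : R) u :
  concave_on S h -> (forall v, l1 v <= 1 -> S v) ->
  (forall v, l1 v <= 1 -> `|h v + 2^-1 * quadf J v| <= eta) ->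
  eta <= lam / 8 -> S u -> 1 <= l1 u -> h u <= - (lam / 4) * l1 u.
Proof.
move=> ch S1 h1 eta8 Su L1.
have Lu0 : 0 < l1 u by exact: lt_le_trans L1.
have l01 : 0 <= (l1 u)^-1 <= 1 by rewrite invr_ge0 l1_ge0 invf_le1.
have S0 : S 0 by apply: S1; rewrite l1_0.
have := ch _ _ Su S0 _ l01; rewrite scaler0 addr0.
set v := _ *: u => hv.
have lv : l1 v = 1 by rewrite l1Z ger0_norm ?(andP l01).1// mulVf ?gt_eqF.
have : l1 v <= 1 by rewrite lv.
move=> /h1; rewrite ler_norml => /andP[_ h2].
have : `|h 0 + 2^-1 * quadf J 0| <= eta by apply: h1; rewrite l1_0.
rewrite quadf0 mulr0 addr0 ler_norml => /andP[h3 _].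
have := Jlam v; rewrite lv expr1n mulr1 => h4.
have h5 : h u + (l1 u - 1) * h 0 <= l1 u * h v.
  rewrite (_ : h u + _ = l1 u * ((l1 u)^-1 * h u + (1 - (l1 u)^-1) * h 0)).
    by rewrite ler_wpM2l// ltW.
  by field; rewrite gt_eqF.
have h6 : (l1 u - 1) * (- (lam / 8)) <= (l1 u - 1) * h 0 by rewrite ler_wpM2l//; lra.
have h7 : l1 u * h v <= l1 u * (lam / 8 - 2^-1 * lam) by rewrite ler_wpM2l//; lra.
have lam0' := lam0; lra.
Qed.

Let expR_sq (x : R) : 0 <= x -> x ^+ 2 / 4 <= expR x.
Proof.
move=> x0; rewrite [expR x](_ : _ = expR (x / 2) ^+ 2); last first.
  by rewrite expr2 -expRD; congr expR; field.
have h := expR_ge1Dx (x / 2).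
have -> : x ^+ 2 / 4 = (x / 2) ^+ 2 by field.
by rewrite lerXn2r ?nnegrE ?expR_ge0//; lra.
Qed.

(** The factor [1 + l1 u] lets one estimate serve the total mass and the first moments. Outside
    radius [M] the decay [lam / 4] of the density beats the growth [lam / 8] of the weight, leaving
    [lam / 8 = 2 * c]; one [c] stays in the bound, the other absorbs the polynomial factor and the
    constants. *)
Lemma concave_gauss_approx (C kappa : R) : 0 <= C -> 0 < kappa ->
  exists M eta : R, [/\ 1 <= M, 0 < eta & forall (S : set 'rV[R]_p) (h w : 'rV[R]_p -> R),
    concave_on S h -> (forall u, l1 u <= M -> S u) ->
    (forall u, l1 u <= M -> `|h u + 2^-1 * quadf J u| <= eta) ->
    (forall u, S u -> 0 <= w u <= C * expR (lam / 8 * l1 u)) ->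
    (forall u, l1 u <= M -> `|w u - 1| <= eta) ->
    forall u, (1 + l1 u) * `|\1_S u * expR (h u) * w u - expR (- (2^-1 * quadf J u))| <=
       kappa * expR (- (lam / 16) * l1 u)].
Proof.
move=> C0 k0; pose c := lam / 16; have c0 : 0 < c by rewrite divr_gt0.
(* Beyond this radius [8 * (C + 1) <= kappa * c ^+ 2 * l1 u], which with [x ^+ 2 / 4 <= expR x] at
   [x = c * l1 u] absorbs [(1 + l1 u) * (C + 1)]. *)
pose M := 1 + 8 * (C + 1) / (kappa * c ^+ 2).
have kc : 0 < kappa * c ^+ 2 by rewrite mulr_gt0// exprn_gt0.
have M1 : 1 <= M by rewrite /M lerDl divr_ge0 ?(ltW kc)//; lra.
(* An error of [k'], multiplied by the largest factor [1 + M], meets the target at its smallest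
   value on the ball, at radius [M]. *)
pose k' := kappa * expR (- c * M) / (1 + M).
have k'0 : 0 < k' by rewrite divr_gt0 ?mulr_gt0 ?expR_gt0//; lra.
(* The bound [1 / 2] gives [expR dl <= 1 + 2 * eta], [lam / 8] is what [concave_tail] asks for, and
   the relative error inside the ball is at most [5 * eta]. *)
pose eta := Num.min (2^-1) (Num.min (lam / 8) (k' / 5)).
have eta0 : 0 < eta.
  rewrite /eta !lt_min; apply/andP; split; first lra.
  by apply/andP; split; apply: divr_gt0.
have eta1 : eta <= 2^-1 by rewrite ge_min lexx.
have eta2 : eta <= lam / 8 by rewrite !ge_min lexx orbT.
have eta3 : eta <= k' / 5 by rewrite !ge_min lexx !orbT.
exists M, eta; split => // S h w ch SM hM wC wM u.
have q0 : 0 <= quadf J u.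
  by apply: le_trans (Jlam u); rewrite mulr_ge0 ?(ltW lam0)// sqr_ge0.
have [uM|Mu] := leP (l1 u) M.
  rewrite indicE mem_set ?mul1r; last exact: SM.
  set q := 2^-1 * quadf J u.
  have -> : expR (h u) * w u - expR (- q) = expR (- q) * (expR (h u + q) * w u - 1).
    by rewrite mulrBr mulrA -expRD mulr1 addrA [- q + h u]addrC -addrA [- q + q]addrC subrr addr0.
  set dl := h u + q; have := hM _ uM; rewrite -/q -/dl ler_norml => /andP[d1 d2].
  have e1 : 1 - eta <= expR dl by have := expR_ge1Dx dl; lra.
  have e2 : expR dl <= 1 + 2 * eta.
    have := expR_ge1Dx (- dl); rewrite expRN => h1.
    have h2 : 1 - eta <= (expR dl)^-1 by lra.
    have h3 : (1 - eta) * expR dl <= 1 by rewrite -ler_pdivlMr ?expR_gt0// div1r.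
    have h4 : (1 - eta) * expR dl <= (1 - eta) * (1 + 2 * eta).
      apply: (le_trans h3); nra.
    by move: h4; rewrite ler_pM2l//; lra.
  have := wM _ uM; rewrite ler_norml => /andP[w1 w2].
  have h5 : `|expR dl * w u - 1| <= 5 * eta.
    rewrite (_ : expR dl * w u - 1 = (expR dl - 1) * w u + (w u - 1)); last by ring.
    apply: (le_trans (ler_normD _ _)); rewrite normrM.
    have a1 : `|expR dl - 1| <= 2 * eta by rewrite ler_norml; apply/andP; split; lra.
    have a2 : `|w u| <= 2 by rewrite ler_norml; apply/andP; split; lra.
    have a3 : `|w u - 1| <= eta by rewrite ler_norml; apply/andP; split; lra.
    have := ler_pM (normr_ge0 _) (normr_ge0 _) a1 a2; lra.
  rewrite normrM ger0_norm ?expR_ge0//.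
  have h6 : expR (- q) <= 1 by rewrite -expR0 ler_expR oppr_le0 mulr_ge0.
  have h7 : expR (- q) * `|expR dl * w u - 1| <= k'.
    rewrite -[k']mul1r ler_pM ?expR_ge0//; lra.
  apply: (@le_trans _ _ ((1 + M) * k')).
    by rewrite ler_pM ?addr_ge0 ?l1_ge0 ?mulr_ge0 ?expR_ge0//; lra.
  rewrite /k' mulrC divfK; last by rewrite gt_eqF//; lra.
  by rewrite ler_pM2l// ler_expR !mulNr lerN2 ler_pM2l.
have L1 : 1 <= l1 u by rewrite ltW// (le_lt_trans M1).
have L0 := l1_ge0 u.
have G1 : expR (- (2^-1 * quadf J u)) <= expR (- (2 * c) * l1 u).
  rewrite ler_expR /c; have := Jlam u.
  have : lam * l1 u <= lam * l1 u ^+ 2 by rewrite ler_pM2l// expr2 ler_peMl.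
  have : 0 <= lam * l1 u by rewrite mulr_ge0// ltW.
  lra.
have g1 : `|\1_S u * expR (h u) * w u| <= C * expR (- (2 * c) * l1 u).
  rewrite indicE; case: (boolP (u \in S)) => [/set_mem Su|_]; last first.
    by rewrite !mul0r normr0 mulr_ge0// expR_ge0.
  have /andP[w0 wle] := wC _ Su.
  rewrite mul1r ger0_norm ?mulr_ge0 ?expR_ge0//.
  have ht : h u <= - (lam / 4) * l1 u.
    by apply: (concave_tail ch _ _ eta2 Su L1) => v v1; [apply: SM|apply: hM]; exact: le_trans v1 M1.
  rewrite (_ : - (2 * c) * l1 u = - (lam / 4) * l1 u + lam / 8 * l1 u); last by rewrite /c; field.
  by rewrite expRD mulrCA ler_pM ?expR_ge0// ler_expR.
apply: (@le_trans _ _ ((1 + l1 u) * ((C + 1) * expR (- (2 * c) * l1 u)))).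
  rewrite ler_wpM2l ?addr_ge0//; apply: (le_trans (ler_normB _ _)).
  by rewrite mulrDl mul1r lerD// ger0_norm ?expR_ge0.
rewrite (_ : - (2 * c) * l1 u = - c * l1 u + - c * l1 u); last by ring.
rewrite expRD !mulrA -/c ler_wpM2r ?expR_ge0//.
rewrite mulNr expRN ler_pdivrMr ?expR_gt0//.
apply: (@le_trans _ _ (kappa * ((c * l1 u) ^+ 2 / 4))); last first.
  by rewrite ler_pM2l//; apply: expR_sq; rewrite mulr_ge0// ltW.
have h8 : 8 * (C + 1) <= kappa * c ^+ 2 * l1 u.
  by rewrite [leRHS]mulrC -ler_pdivrMr//; move: Mu; rewrite /M; lra.
have h9 := ler_wpM2r L0 h8.
have h10 : (1 + l1 u) * (C + 1) <= 2 * l1 u * (C + 1) by rewrite ler_wpM2r//; lra.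
apply: (le_trans h10).
rewrite (_ : kappa * _ = kappa * c ^+ 2 * l1 u * l1 u / 4); last by field.
rewrite ler_pdivlMr//; lra.
Qed.

End expansion.
End concave.

(** * Sums of i.i.d. random variables *)

Section iid.
Context {R : realType} {d : measure_display} {Omega : measurableType d}.
Variables (P : probability Omega R) (Y : nat -> Omega -> R).
Hypothesis mY : forall i, measurable_fun setT (Y i).
Hypothesis indepY : mutually_independent P Y.
Hypothesis lawY : forall i (A : set R), measurable A -> P (Y i @^-1` A) = P (Y 0%N @^-1` A).

Let RVY i : {RV P >-> R} := HB.pack (Y i) (isMeasurableFun.Build _ _ _ _ _ (mY i)).

Lemma measurable_comp_iid (g : R -> R) i : measurable_fun setT g ->
  measurable_fun setT (fun w => g (Y i w)).
Proof. by move=> mg; exact: (measurableT_comp mg (mY i)). Qed.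

Lemma ge0_integral_iid (g : R -> \bar R) i : measurable_fun setT g -> (forall x, 0 <= g x)%E ->
  (\int[P]_w g (Y i w) = \int[P]_w g (Y 0%N w))%E.
Proof.
move=> mg g0.
rewrite -[LHS](ge0_integral_distribution (RVY i) mg g0).
rewrite -[RHS](ge0_integral_distribution (RVY 0) mg g0).
by apply: eq_measure_integral => A mA _; exact: lawY.
Qed.

Lemma integrable_iid (g : R -> R) i : measurable_fun setT g ->
  P.-integrable setT (fun w => (g (Y 0%N w))%:E) ->
  P.-integrable setT (fun w => (g (Y i w))%:E).
Proof.
move=> mg /integrableP[_ h]; apply/integrableP; split.
  by apply/measurable_EFinP; exact: measurable_comp_iid.
rewrite (ge0_integral_iid (g := fun x => `|(g x)%:E|%E))//.
by apply: measurableT_comp => //; exact/measurable_EFinP.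
Qed.

Lemma integral_iid (g : R -> R) i : measurable_fun setT g ->
  P.-integrable setT (fun w => (g (Y 0%N w))%:E) ->
  (\int[P]_w (g (Y i w))%:E = \int[P]_w (g (Y 0%N w))%:E)%E.
Proof.
move=> mg ig; have ig' := integrable_iid i mg ig.
have mgE : measurable_fun setT (EFin \o g) by exact/measurable_EFinP.
rewrite -[LHS](integral_distribution (X := RVY i) mgE)//.
rewrite -[RHS](integral_distribution (X := RVY 0) mgE)//.
by apply: eq_measure_integral => A mA _; exact: lawY.
Qed.

Lemma indep2 i j (A B : set R) : i != j -> measurable A -> measurable B ->
  (P (Y i @^-1` A `&` Y j @^-1` B) = P (Y i @^-1` A) * P (Y j @^-1` B))%E.
Proof.
move=> ij mA mB; pose C k := if k == i then A else B.
have uij : uniq [:: i; j] by rewrite /= inE ij.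
have mC k : measurable (C k) by rewrite /C; case: ifP.
have mpre k (S : set R) : measurable S -> measurable (Y k @^-1` S).
  by move=> mS; rewrite -[X in measurable X]setTI; exact: mY.
have := indepY uij mC.
rewrite !big_cons big_nil mulr1 {2}/C eqxx {2}/C eq_sym (negbTE ij).
rewrite (_ : \bigcap_(_ in _) _ = Y i @^-1` A `&` Y j @^-1` B); last first.
  apply/seteqP; split => [w h|w [hi hj] k /=].
    split; first by have := h i; rewrite /C/= eqxx; apply; rewrite inE eqxx.
    by have := h j; rewrite /C/= eq_sym (negbTE ij); apply; rewrite !inE eqxx orbT.
  by rewrite !inE => /orP[|] /eqP ->; rewrite /C ?eqxx// eq_sym (negbTE ij).
move=> H; have := congr1 EFin H; rewrite EFinM !fineK//; apply: fin_num_measure; rewrite //.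
- exact: mpre.
- exact: mpre.
- by apply: measurableI; exact: mpre.
Qed.

(** * Second moments of centred sums *)

Section centered.
Variable z : R -> R.
Hypothesis mz : measurable_fun setT z.
Hypothesis iz2 : P.-integrable setT (fun w => (z (Y 0%N w) ^+ 2)%:E).
Hypothesis z0 : (\int[P]_w (z (Y 0%N w))%:E = 0)%E.

Let mz2 : measurable_fun setT (fun x => z x ^+ 2).
Proof. exact: measurable_funX. Qed.

Let iz : P.-integrable setT (fun w => (z (Y 0%N w))%:E).
Proof.
have : P.-integrable setT (fun w => (cst 1 w)%:E + (z (Y 0%N w) ^+ 2)%:E)%E.
  by apply: integrableD => //; exact: finite_measure_integrable_cst.
apply: le_integrable => //; first by apply/measurable_EFinP; exact: measurable_comp_iid.
move=> w _; rewrite -EFinD !abse_EFin lee_fin /= [leRHS]ger0_norm; last by rewrite addr_ge0// sqr_ge0.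
have := sqr_ge0 (`|z (Y 0%N w)| - 1); rewrite -(real_normK (num_real (z _))).
have := normr_ge0 (z (Y 0%N w)); set t := `| _ |; nra.
Qed.

Let izz i j : P.-integrable setT (fun w => (z (Y i w) * z (Y j w))%:E).
Proof.
have : P.-integrable setT (fun w => (z (Y i w) ^+ 2)%:E + (z (Y j w) ^+ 2)%:E)%E.
  by apply: integrableD => //; exact: (integrable_iid _ mz2).
apply: le_integrable => //.
  by apply/measurable_EFinP; apply: measurable_funM; exact: measurable_comp_iid.
move=> w _; rewrite -EFinD !abse_EFin lee_fin normrM [leRHS]ger0_norm; last by rewrite addr_ge0// sqr_ge0.
rewrite -(real_normK (num_real (z (Y i w)))) -(real_normK (num_real (z (Y j w)))).
have := normr_ge0 (z (Y i w)); have := normr_ge0 (z (Y j w)).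
set s := `|z (Y i w)|; set t := `|z (Y j w)| => t0 s0.
have := sqr_ge0 (s - t); nra.
Qed.

(** Uniqueness on rectangles identifies the joint law of [Y i] and [Y j] with the product of the
    marginals; in Fubini's theorem the inner integral is then a multiple of the mean 0. *)
Lemma integral_indep_mul0 i j : i != j -> (\int[P]_w (z (Y i w) * z (Y j w))%:E = 0)%E.
Proof.
move=> ij.
have mZ : measurable_fun setT (fun w => (Y i w, Y j w)) by exact: measurable_fun_pair.
pose Z : {RV P >-> (R * R)%type} := HB.pack (fun w => (Y i w, Y j w)) (isMeasurableFun.Build _ _ _ _ _ mZ).
pose m1 := distribution P (RVY i); pose m2 := distribution P (RVY j).
pose g (x : R * R) := (z x.1 * z x.2)%:E.
have mg : measurable_fun setT g.
  by apply/measurable_EFinP; apply: measurable_funM; exact: measurableT_comp.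
have prodE A : measurable A -> (m1 \x m2)%E A = distribution P Z A.
  by apply: product_measure_unique => S T mS mT; exact: indep2.
have ig : (m1 \x m2)%E.-integrable setT g.
  apply/integrableP; split => //.
  rewrite (eq_measure_integral (distribution P Z)); last by move=> A mA _; exact: prodE.
  rewrite ge0_integral_distribution//; last exact: measurableT_comp.
  by have /integrableP[] := izz i j.
rewrite -[LHS](integral_distribution (X := Z) mg); last exact: izz.
rewrite (eq_measure_integral (m1 \x m2)%E); last by move=> A mA _; exact/esym/prodE.
rewrite -integral12_prod_meas1//.
apply: integral0_eq => x _; rewrite /fubini_F /g/=.
under eq_integral do rewrite EFinM.
have mzE : measurable_fun setT (EFin \o z) by exact/measurable_EFinP.
have ij' := integrable_iid j mz iz.
rewrite integralZl//; last exact: (integrable_pushforward (mY j) mzE).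
rewrite (integral_distribution (X := RVY j) mzE)//.
by rewrite [X in (_ * X)%E](_ : _ = 0%E) ?mule0//; rewrite -z0; exact: (integral_iid _ mz).
Qed.

Let S n w := \sum_(i < n) z (Y i w).

(** A partial sum is orthogonal to every later term, which removes the cross term from the second
    moment. *)
Let cross n m : (n <= m)%N -> P.-integrable setT (fun w => (S n w * z (Y m w))%:E) /\
  (\int[P]_w (S n w * z (Y m w))%:E = 0)%E.
Proof.
elim: n => [|n IH] nm.
  rewrite (_ : (fun w => _) = cst 0%E); first by rewrite integral0; split => //; exact: integrable0.
  by apply/funext => w; rewrite /S big_ord0 mul0r.
have [i1 e1] := IH (ltnW nm).
have nm' : n != m by rewrite ltn_eqF.
have fE : (fun w => (S n.+1 w * z (Y m w))%:E) =
    (fun w => (S n w * z (Y m w))%:E + (z (Y n w) * z (Y m w))%:E)%E.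
  by apply/funext => w; rewrite /S big_ord_recr/= mulrDl.
rewrite fE; split; first exact: integrableD.
by rewrite (integralD measurableT i1 (izz n m)) e1 add0e integral_indep_mul0.
Qed.

Lemma integral_sum_sqr n : P.-integrable setT (fun w => (S n w ^+ 2)%:E) /\
  (\int[P]_w (S n w ^+ 2)%:E = n%:R%:E * \int[P]_w (z (Y 0%N w) ^+ 2)%:E)%E.
Proof.
elim: n => [|n [i1 e1]].
  rewrite mul0e (_ : (fun w => _) = cst 0%E).
    by rewrite integral0; split => //; exact: integrable0.
  by apply/funext => w; rewrite /S big_ord0 expr0n.
have [i2 e2] := cross (leqnn n).
have i3 := integrable_iid n mz2 iz2; have e3 := integral_iid n mz2 iz2.
have i4 : P.-integrable setT (fun w => 2%:E * (S n w * z (Y n w))%:E)%E by exact: integrableZl.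
have i5 := integrableD measurableT i4 i3.
have fE : (fun w => (S n.+1 w ^+ 2)%:E) = (fun w => (S n w ^+ 2)%:E +
    (2%:E * (S n w * z (Y n w))%:E + (z (Y n w) ^+ 2)%:E))%E.
  by apply/funext => w; rewrite /S big_ord_recr/= -EFinM -!EFinD; congr EFin; ring.
rewrite fE; split; first exact: integrableD.
rewrite (integralD measurableT i1 i5) e1 (integralD measurableT i4 i3) integralZl// e2 mule0 add0e e3.
rewrite -(fineK (integrable_fin_num measurableT iz2)) -!EFinM -EFinD.
by congr EFin; rewrite -natr1; ring.
Qed.

Lemma measurable_sum_iid n : measurable_fun setT (S n).
Proof. by apply: measurable_sum => i; exact: measurable_comp_iid. Qed.

Lemma iid_chebyshev (v a : R) n : 0 < a -> (\int[P]_w (z (Y 0%N w) ^+ 2)%:E <= v%:E)%E ->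
  measurable [set w | a <= `|S n w|] /\ (P [set w | (a <= `|S n w|)%R] <= (n%:R * v / a ^+ 2)%:E)%E.
Proof.
move=> a0 zv; have mS := measurable_sum_iid n.
split.
  rewrite (_ : [set _ | _] = (fun w => `|S n w|) @^-1` `[a, +oo[%classic).
    rewrite -[X in measurable X]setTI; apply: (measurableT_comp (@normr_measurable R setT) mS) => //.
  by apply/seteqP; split => w /=; rewrite in_itv/= andbT.
pose X : {RV P >-> R} := HB.pack (S n) (isMeasurableFun.Build _ _ _ _ _ mS).
have := @markov _ _ _ P X (fun x => x ^+ 2) a a0.
rewrite unlock /= => H.
rewrite EFinM lee_pdivlMr ?exprn_gt0// muleC.
apply: le_trans (H _ _ _ ) _.
- exact: exprn_measurable.
- by move=> r _; exact: sqr_ge0.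
- by move=> x y; rewrite !nnegrE => x0 y0; rewrite ler_sqr.
have [_ e] := integral_sum_sqr n.
rewrite (eq_integral (fun w => (S n w ^+ 2)%:E)); last first.
  by move=> w _ /=; rewrite real_normK// num_real.
by rewrite e EFinM lee_wpmul2l.
Qed.

End centered.
End iid.

(** * Posterior mean of a nearly Gaussian density *)

Section concave_ops.
Context {R : realType}.
Variables (p : nat).
Implicit Types (S : set 'rV[R]_p) (k : 'rV[R]_p -> R).

Lemma concave_affine S k (a : R) (b : 'rV[R]_p) : concave_on S k ->
  concave_on [set u | S (a *: u + b)] (fun u => k (a *: u + b)).
Proof.
move=> ck x y Sx Sy l l01.
have -> : a *: (l *: x + (1 - l) *: y) + b = l *: (a *: x + b) + (1 - l) *: (a *: y + b).
  by apply/rowP => i; rewrite !mxE; ring.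
exact: ck.
Qed.

Lemma dotrDr (U s t : 'rV[R]_p) : dotr U (s + t) = dotr U s + dotr U t.
Proof. by rewrite /dotr linearD /= mulmxDr mxE. Qed.

Lemma dotrZr (U s : 'rV[R]_p) a : dotr U (a *: s) = a * dotr U s.
Proof. by rewrite /dotr linearZ /= -scalemxAr mxE. Qed.

Lemma concave_add_affine S k (U : 'rV[R]_p) (c : R) : concave_on S k ->
  concave_on S (fun s => k s + dotr U s + c).
Proof.
move=> ck x y Sx Sy l l01; rewrite dotrDr !dotrZr.
by have := ck _ _ Sx Sy _ l01; lra.
Qed.

Lemma concave_sum S n (k : 'I_n -> 'rV[R]_p -> R) : (forall i, concave_on S (k i)) ->
  concave_on S (fun s => \sum_i k i s).
Proof.
move=> ck x y Sx Sy l l01; rewrite !mulr_sumr -big_split; apply: ler_sum => i _.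
exact: ck.
Qed.

(** Concavity yields Borel measurability in the parameter: [k] is continuous on the open set [S], so
    the superlevel sets are open. *)
Lemma measurable_expR_concave S k : open S -> concave_on S k ->
  measurable_fun setT ((fun u => \1_S u * expR (k u)) : rVB p -> R).
Proof.
move=> oS ck; apply: measurable_rVB_fun => a.
have [a0|a0] := ltP a 0.
  rewrite (_ : [set _ | _] = setT); first exact: measurableT.
  by apply/seteqP; split => // v _ /=; rewrite (lt_le_trans a0)// mulr_ge0 ?expR_ge0.
apply: measurable_rVB_open; apply: open_l1 => x /=.
rewrite indicE; case: (boolP (x \in S)) => [/set_mem Sx|_]; last first.
  by rewrite mul0r => /(le_lt_trans a0); rewrite ltxx.
rewrite mul1r => ax.
(* In the first case [a] is 0, where [lnK] does not apply; positivity of the exponential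
   suffices. *)
have [a1|a1] := leP a 0.
  have [e e0 He] := concave_continuous oS ck Sx ltr01.
  exists e => // y /He[Sy _]; rewrite indicE mem_set// mul1r.
  by rewrite (le_lt_trans a1)// expR_gt0.
have kx : 0 < k x - ln a by rewrite subr_gt0 -ltr_expR lnK.
have [e e0 He] := concave_continuous oS ck Sx kx.
exists e => // y /He[Sy]; rewrite indicE mem_set// mul1r ltr_norml => /andP[h _].
by rewrite -[X in X < _](lnK a1) ltr_expR; lra.
Qed.

Lemma measurable_indic_mul S (f : 'rV[R]_p -> R) : (forall u, 0 <= f u) -> rV_borel_on S f ->
  measurable_fun setT ((fun u => \1_S u * f u) : rVB p -> R).
Proof.
move=> f0 bf; apply: measurable_rVB_fun => a.
have [a0|a0] := ltP a 0.
  rewrite (_ : [set _ | _] = setT); first exact: measurableT.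
  by apply/seteqP; split => // v _ /=; rewrite (lt_le_trans a0)// mulr_ge0.
rewrite (_ : [set _ | _] = S `&` f @^-1` `]a, +oo[%classic); first exact: bf.
apply/seteqP; split => v /=; rewrite indicE in_itv/= andbT.
  case: (boolP (v \in S)) => [/set_mem Sv|_]; first by rewrite mul1r.
  by rewrite mul0r => /(le_lt_trans a0); rewrite ltxx.
by move=> [Sv ?]; rewrite mem_set// mul1r.
Qed.

End concave_ops.

(** * Comparison of posterior integrals with Gaussian ones *)

Section posterior.
Context {R : realType}.
Variables (p : nat) (J : 'M[R]_p) (lam : R).
Hypothesis lam0 : 0 < lam.
Hypothesis Jlam : forall u, lam * l1 u ^+ 2 <= quadf J u.

Lemma expdom_moment (g : 'rV[R]_p -> R) (K c : R) : 0 < c ->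
  measurable_fun setT (g : rVB p -> R) ->
  (forall u, (1 + l1 u) * `|g u| <= K * expR (- c * l1 u)) ->
  expdom g /\ forall j, expdom (fun u => u ord0 j * g u).
Proof.
move=> c0 mg gK; split.
  split => //; exists K, c; split => // u; apply: le_trans (gK u).
  by rewrite ler_peMl// lerDl l1_ge0.
move=> j; split; first by apply: measurable_funM => //; exact: measurable_rVB_coord.
exists K, c; split => // u; apply: le_trans (gK u).
rewrite normrM ler_wpM2r// (le_trans (le_coord_l1 _ _))// lerDr//.
Qed.

Definition gauss (u : 'rV[R]_p) : R := expR (- (2^-1 * quadf J u)).

Lemma measurable_gauss : measurable_fun setT (gauss : rVB p -> R).
Proof.
apply: (measurableT_comp (f := expR)) => //; apply: measurableT_comp => //.
apply: measurable_funM => //; apply: continuous_rVB_measurable; exact: continuous_quadf.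
Qed.

Lemma gauss_decay (c : R) : exists2 K : R, 0 <= K & forall u, (1 + l1 u) * gauss u <= K * expR (- c * l1 u).
Proof.
(* The extra 1 pays for [1 + l1 u <= expR (l1 u)]; completing the square in
   [lam / 2 * l1 u ^+ 2 - a * l1 u] gives the constant. *)
pose a := c + 1; exists (expR (a ^+ 2 / (2 * lam))); first exact: expR_ge0.
move=> u; apply: (@le_trans _ _ (expR (l1 u) * gauss u)).
  by rewrite ler_wpM2r ?expR_ge0// expR_ge1Dx.
rewrite /gauss -!expRD ler_expR.
have h := sqr_ge0 (lam * l1 u - a).
have h2 : 0 <= (lam * l1 u - a) ^+ 2 / (2 * lam) by rewrite divr_ge0// mulr_ge0// ltW.
have e : (lam * l1 u - a) ^+ 2 / (2 * lam) = 2^-1 * (lam * l1 u ^+ 2) - a * l1 u + a ^+ 2 / (2 * lam).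
  by field; rewrite gt_eqF.
have := Jlam u; rewrite e in h2; rewrite /a in h2 *; lra.
Qed.

Lemma expdom_gauss : expdom gauss /\ forall j, expdom (fun u => u ord0 j * gauss u).
Proof.
have [K K0 HK] := gauss_decay 1.
apply: (expdom_moment (K := K) ltr01 measurable_gauss) => u.
by rewrite ger0_norm ?expR_ge0.
Qed.

Lemma Iint_gauss_gt0 : 0 < Iint gauss.
Proof. by apply: Iint_gt0 => [|u]; [exact: expdom_gauss.1|exact: expR_gt0]. Qed.

Lemma Iint_gauss_coord j : Iint (fun u => u ord0 j * gauss u) = 0.
Proof.
apply: Iint_odd => [|u]; first exact: expdom_gauss.2.
by rewrite /gauss quadfN mxE mulNr.
Qed.

(** In the variable [u] the factor [c0] and the Jacobian cancel from the ratio, leaving the first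
    moment of [g] over its mass. The moment is within [kappa * W] of the vanishing Gaussian one, and
    the mass is at least half the Gaussian mass. *)
Lemma posterior_mean_close (c kappa W : R) (F g : 'rV[R]_p -> R) (c0 rn : R) (th0 m : 'rV[R]_p) :
  0 < c -> 0 <= W ->
  (forall (g : 'rV[R]_p -> R) (K : R),
     measurable_fun setT (g : rVB p -> R) -> (forall u, `|g u| <= K * expR (- c * l1 u)) ->
     `|Iint g| <= K * W) ->
  kappa * W <= Iint gauss / 2 ->
  measurable_fun setT (F : rVB p -> R) -> 0 < c0 -> 0 < rn ->
  (forall u, F (rn^-1 *: (m + u) + th0) = c0 * g u) ->
  (forall u, (1 + l1 u) * `|g u - gauss u| <= kappa * expR (- c * l1 u)) ->
  [/\ (0 < iint (fun th => (F th)%:E) < +oo)%E,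
      (forall j, iint (fun th => (`|th ord0 j| * F th)%:E) < +oo)%E &
      forall j, `|rn * (fine (iint (fun th => (th ord0 j * F th)%:E)) /
                 fine (iint (fun th => (F th)%:E)) - th0 ord0 j) - m ord0 j| <=
          kappa * W / (Iint gauss / 2)].
Proof.
move=> c_gt0 W0 HW kW mF c00 rn0 Fg gG.
have rnN0 : rn != 0 by rewrite gt_eqF.
have rnV0 : rn^-1 != 0 by rewrite invr_eq0.
have c0N0 : c0 != 0 by rewrite gt_eqF.
pose b := rn^-1 *: m + th0.
have gE : g = fun u => c0^-1 * F (rn^-1 *: u + b).
  by apply/funext => u; rewrite /b addrA -scalerDr [u + m]addrC Fg mulrA mulVf// mul1r.
have mg : measurable_fun setT (g : rVB p -> R).
  rewrite gE; apply: measurable_funM => //.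
  exact: (measurableT_comp mF (measurable_rVB_affine _ _)).
have [K K0 HK] := gauss_decay c.
have gK u : (1 + l1 u) * `|g u| <= (kappa + K) * expR (- c * l1 u).
  have h2 := gG u; have h1 := HK u; rewrite [leRHS]mulrDl.
  apply: le_trans (lerD h2 h1); rewrite -mulrDr ler_wpM2l ?addr_ge0 ?l1_ge0//.
  by rewrite -[g u in leLHS](subrK (gauss u)) (le_trans (ler_normD _ _))// lerD2l ger0_norm// expR_ge0.
have [gd gdj] := expdom_moment c_gt0 mg gK.
have [Gd Gdj] := expdom_gauss.
have IG0 := Iint_gauss_gt0.
have gG1 u : `|-1 * gauss u + g u| <= kappa * expR (- c * l1 u).
  by rewrite mulN1r addrC; apply: le_trans (gG u); rewrite ler_peMl// lerDl l1_ge0.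
have Ig : Iint gauss / 2 <= Iint g.
  have md : measurable_fun setT ((fun u => -1 * gauss u + g u) : rVB p -> R).
    by apply: measurable_funD => //; apply: measurable_funM => //; exact: measurable_gauss.
  have := HW _ _ md gG1; rewrite Iint_lin// ler_norml => /andP[h _]; lra.
have Ig0 : 0 < Iint g by apply: lt_le_trans Ig; rewrite divr_gt0.
have Ij j : `|Iint (fun u => u ord0 j * g u)| <= kappa * W.
  have -> : Iint (fun u => u ord0 j * g u) =
      Iint (fun u => -1 * (u ord0 j * gauss u) + u ord0 j * g u).
    by rewrite Iint_lin// Iint_gauss_coord mulr0 add0r.
  apply: HW.
    have mc := measurable_rVB_coord (R := R) j.
    apply: measurable_funD; last exact: measurable_funM.
    apply: measurable_funM => //; apply: measurable_funM => //; exact: measurable_gauss.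
  move=> u; apply: le_trans (gG u).
  rewrite (_ : -1 * _ + _ = u ord0 j * (g u - gauss u)); last by ring.
  by rewrite normrM ler_wpM2r// (le_trans (le_coord_l1 _ _))// lerDr.
(* The inverse substitution [u = rn * (th - th0) - m], which carries integrability and integrals
   from [g] back to [F]. *)
pose b' := - (rn *: th0) - m.
have Fth th : F th = c0 * g (rn *: th + b').
  rewrite -Fg; congr F; apply/rowP => i; rewrite !mxE; field; exact: rnN0.
have FE : F = fun th => c0 * g (rn *: th + b') by apply/funext.
have gad := expdom_affine b' rnN0 gd.
have Fd : expdom F by rewrite FE; exact: (expdomZ c0 gad).
pose al j := th0 ord0 j + rn^-1 * m ord0 j.
pose hj j (u : 'rV[R]_p) := rn^-1 * (u ord0 j * g u) + al j * g u.
have hjd j : expdom (hj j) by apply: expdomD; apply: expdomZ.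
have FjE j : (fun th : 'rV[R]_p => th ord0 j * F th) = fun th => c0 * hj j (rn *: th + b').
  apply/funext => th; rewrite Fth /hj /al; set gg := g _; rewrite !mxE; field; exact: rnN0.
have Fjd j : expdom (fun th => th ord0 j * F th).
  by rewrite FjE; apply: (expdomZ c0); exact: expdom_affine.
have IF : Iint F = c0 * (`|rn|^-1 ^+ p * Iint g).
  by rewrite FE (IintZ c0 gad) Iint_affine.
have IFj j : Iint (fun th => th ord0 j * F th) =
    c0 * (`|rn|^-1 ^+ p * (rn^-1 * Iint (fun u => u ord0 j * g u) + al j * Iint g)).
  rewrite FjE (IintZ c0 (expdom_affine b' rnN0 (hjd j))) Iint_affine//.
  by rewrite /hj Iint_lin ?IintZ//; exact: expdomZ.
have rp0 : 0 < `|rn|^-1 ^+ p by rewrite exprn_gt0// invr_gt0 normr_gt0.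
split.
- by rewrite IintE// lte_fin ltry andbT IF !mulr_gt0.
- move=> j; rewrite (IintE (g := fun th => `|th ord0 j| * F th)) ?ltry//.
  have [mm [K' [c' [c'0 HK']]]] := Fjd j; split.
    apply: measurable_funM => //; apply: measurableT_comp => //; exact: measurable_rVB_coord.
  by exists K', c'; split => // u; apply: le_trans (HK' u); rewrite !normrM normr_id.
move=> j.
rewrite -/(Iint F) -/(Iint (fun th => th ord0 j * F th)) IFj IF.
set Iu := Iint (fun u => u ord0 j * g u).
have -> : rn * (c0 * (`|rn|^-1 ^+ p * (rn^-1 * Iu + al j * Iint g)) /
    (c0 * (`|rn|^-1 ^+ p * Iint g)) - th0 ord0 j) - m ord0 j = Iu / Iint g.
  rewrite /al; field; rewrite rnN0 c0N0 !gt_eqF//.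
rewrite normrM normfV (ger0_norm (ltW Ig0)) ler_pM ?invr_ge0 ?(ltW Ig0)//; first exact: Ij.
by rewrite lef_pV2// posrE// divr_gt0.
Qed.

End posterior.

(** * Events of high probability *)

Section high_probability.
Context {R : realType} {d : measure_display} {Omega : measurableType d}.
Variable P : probability Omega R.
Implicit Types E : nat -> set Omega.

(* The set E n need not be measurable: its complement has outer probability at most b. *)
Definition whp (b : R) E : Prop := \forall n \near \oo,
  exists B : set Omega, [/\ measurable B, ~` B `<=` E n & (P B <= b%:E)%E].

Lemma wp_tends_to_oneP E : wp_tends_to_one P E <-> forall b, 0 < b -> whp b E.
Proof.
split=> h b b0; move: (h b b0); apply: filterS => n [A [mA AE PA]]; exists (~` A).
  split; [exact: measurableC|by rewrite setCK|].
  rewrite probability_setC// leeBlDr ?fin_num_measure//.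
  by rewrite -leeBlDl ?fin_num_measure// -EFinB.
split; [exact: measurableC|by []|].
by rewrite probability_setC// EFinB leeB.
Qed.

Lemma whpI b1 b2 E1 E2 : whp b1 E1 -> whp b2 E2 -> whp (b1 + b2) (fun n => E1 n `&` E2 n).
Proof.
move=> h1 h2; near=> n.
have [B1 [mB1 s1 P1]] : exists B : set Omega, [/\ measurable B, ~` B `<=` E1 n & (P B <= b1%:E)%E].
  by near: n.
have [B2 [mB2 s2 P2]] : exists B : set Omega, [/\ measurable B, ~` B `<=` E2 n & (P B <= b2%:E)%E].
  by near: n.
exists (B1 `|` B2); split; first exact: measurableU.
  by rewrite setCU => w [w1 w2]; split; [exact: s1|exact: s2].
apply: (@le_trans _ _ (P B1 + P B2)%E); first exact: measureU2.
by rewrite EFinD leeD.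
Unshelve. all: by end_near. Qed.

Lemma whp_all (T : eqType) (s : seq T) (E : T -> nat -> set Omega) b :
  (forall v, v \in s -> whp b (E v)) ->
  whp ((size s)%:R * b) (fun n => [set w | forall v, v \in s -> E v n w]).
Proof.
elim: s => [|x s IH] h.
  apply: filterE => n; exists set0; split; [exact: measurable0| |by rewrite measure0 mul0r].
  by move=> w _ v.
rewrite /= -natr1 mulrDl mul1r addrC.
have := whpI (h x (mem_head _ _)) (IH (fun v vs => h v (@mem_behead _ (x :: s) v vs))).
apply: filterS => n [B [mB BE PB]]; exists B; split => // w /BE[w1 w2] v.
by rewrite inE => /orP[/eqP->//|]; exact: w2.
Qed.

Lemma whpW b1 b2 E1 E2 : b1 <= b2 -> (\forall n \near \oo, E1 n `<=` E2 n) -> whp b1 E1 -> whp b2 E2.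
Proof.
move=> b12 E12 h; near=> n.
have [B [mB BE PB]] : exists B : set Omega, [/\ measurable B, ~` B `<=` E1 n & (P B <= b1%:E)%E].
  by near: n.
exists B; split => //; last by rewrite (le_trans PB)// lee_fin.
apply: subset_trans BE _; near: n; exact: E12.
Unshelve. all: by end_near. Qed.

End high_probability.

Lemma near_sqrt_gt (R : realType) (a : R) : \forall n \near \oo, a < Num.sqrt (n%:R : R).
Proof.
have [N HN] : exists N : nat, `|a| ^+ 2 < N%:R.
  by exists (Num.truncn (`|a| ^+ 2)).+1; rewrite Num.Theory.truncnS_gt.
exists N => // n /= Nn; apply: le_lt_trans (ler_norm a) _.
rewrite -(ger0_norm (normr_ge0 a)) -sqrtr_sqr ltr_sqrt; first by rewrite (lt_le_trans HN)// ler_nat.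
by rewrite (lt_le_trans (le_lt_trans (sqr_ge0 _) HN))// ler_nat.
Qed.

(** * Chebyshev bounds for the score and for the remainder *)

Section score.
Context {R : realType} {d : measure_display} {Omega : measurableType d}.
Variables (P : probability Omega R) (Y : nat -> Omega -> R).
Hypothesis mY : forall i, measurable_fun setT (Y i).
Hypothesis indepY : mutually_independent P Y.
Hypothesis lawY : forall i (A : set R), measurable A -> P (Y i @^-1` A) = P (Y 0%N @^-1` A).

Lemma whp_score_bounded (z : R -> R) (b : R) :
  measurable_fun setT z -> P.-integrable setT (fun w => (z (Y 0%N w) ^+ 2)%:E) ->
  (\int[P]_w (z (Y 0%N w))%:E = 0)%E -> 0 < b ->
  exists2 B : R, 0 < B &
    whp P b (fun n => [set w | `|(Num.sqrt n%:R)^-1 * \sum_(i < n) z (Y i w)| <= B]).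
Proof.
move=> mz iz2 z0 b0.
pose v := fine (\int[P]_w (z (Y 0%N w) ^+ 2)%:E).
have vE : (\int[P]_w (z (Y 0%N w) ^+ 2)%:E)%E = v%:E by rewrite fineK// integrable_fin_num.
have v0 : 0 <= v.
  by rewrite fine_ge0// integral_ge0// => w _; rewrite lee_fin sqr_ge0.
(* With this choice [v <= b * B <= b * B ^+ 2], so the Chebyshev bound [v / B ^+ 2] is at most
   [b]. *)
pose B := 1 + v / b; have vb0 : 0 <= v / b by rewrite divr_ge0// ltW.
have B1 : 1 <= B by rewrite lerDl.
have B0 : 0 < B by exact: lt_le_trans B1.
exists B => //; near=> n.
have rn0 : 0 < Num.sqrt (n%:R : R) by near: n; exact: near_sqrt_gt.
have n0 : 0 < n%:R :> R by rewrite -sqrtr_gt0.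
have aB : 0 < Num.sqrt n%:R * B by exact: mulr_gt0.
have vle : (\int[P]_w (z (Y 0%N w) ^+ 2)%:E <= v%:E)%E by rewrite vE.
have [mS PS] := iid_chebyshev mY indepY lawY mz iz2 z0 n aB vle.
exists [set w | Num.sqrt n%:R * B <= `|\sum_(i < n) z (Y i w)|]; split => //.
  move=> w /= /negP; rewrite -ltNge => /ltW h.
  by rewrite normrM ger0_norm ?invr_ge0 ?(ltW rn0)// ler_pdivrMl.
apply: (le_trans PS); rewrite lee_fin exprMn sqr_sqrtr ?ler0n// -mulf_div divff ?gt_eqF// mul1r.
rewrite ler_pdivrMr ?exprn_gt0//.
have : v <= b * B by rewrite /B mulrDr mulr1 [b * _]mulrC divfK ?gt_eqF// lerDr ltW.
move=> h; apply: (le_trans h); rewrite ler_pM2l// expr2 ler_peMl// ltW.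
Unshelve. all: by end_near. Qed.

(** A triangular array: each term has mean [- q / n] up to [o(1 / n)] and variance [o(1 / n)], so
    the sum has mean tending to [- q] and variance tending to 0. *)
Lemma whp_iid_sum (z : nat -> R -> R) (q del : R) :
  (forall e : R, 0 < e -> \forall n \near \oo, [/\ measurable_fun setT (z n),
     P.-integrable setT (fun w => (z n (Y 0%N w))%:E),
     (`|'E_P[fun w => z n (Y 0%N w)] + (q / n%:R)%:E| <= (e / n%:R)%:E)%E &
     ('V_P[fun w => z n (Y 0%N w)] <= (e / n%:R)%:E)%E]) ->
  0 < del -> forall b, 0 < b ->
  whp P b (fun n => [set w | `|\sum_(i < n) z n (Y i w) + q| <= del]).
Proof.
move=> hz del0 b b0.
have d20 : 0 < del / 2 by rewrite divr_gt0.
(* The first bound keeps the bias below [del / 2], the second makes Chebyshev's inequality at level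
   [del / 2] cost at most [b]. *)
pose e := Num.min (del / 2) (b * (del / 2) ^+ 2).
have e0 : 0 < e by rewrite lt_min d20 mulr_gt0// exprn_gt0.
have e1 : e <= del / 2 by rewrite ge_min lexx.
have e2 : e <= b * (del / 2) ^+ 2 by rewrite ge_min lexx orbT.
near=> n.
have n0 : 0 < n%:R :> R by rewrite ltr0n; near: n; exact: nbhs_infty_gt.
have [mz iz Ez Vz] : [/\ measurable_fun setT (z n),
     P.-integrable setT (fun w => (z n (Y 0%N w))%:E),
     (`|'E_P[fun w => z n (Y 0%N w)] + (q / n%:R)%:E| <= (e / n%:R)%:E)%E &
     ('V_P[fun w => z n (Y 0%N w)] <= (e / n%:R)%:E)%E] by near: n; exact: hz.
pose mu := fine 'E_P[fun w => z n (Y 0%N w)].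
have EE : ('E_P[fun w => z n (Y 0%N w)])%E = mu%:E.
  by rewrite /mu unlock fineK// integrable_fin_num.
pose zc x := z n x - mu.
have mzc : measurable_fun setT zc by apply: measurable_funB.
have mzY : measurable_fun setT (fun w => (zc (Y 0%N w) ^+ 2)%:E).
  apply/measurable_EFinP; apply: measurable_funX.
  exact: (measurableT_comp mzc (mY 0)).
have V2 : (\int[P]_w (zc (Y 0%N w) ^+ 2)%:E <= (e / n%:R)%:E)%E.
  move: Vz; rewrite /variance covariance.unlock EE expectation.unlock /=.
  by under eq_integral do rewrite -expr2.
have izc2 : P.-integrable setT (fun w => (zc (Y 0%N w) ^+ 2)%:E).
  apply/integrableP; split => //.
  under eq_integral do rewrite gee0_abs ?lee_fin ?sqr_ge0//.
  exact: le_lt_trans V2 (ltry _).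
have zc0 : (\int[P]_w (zc (Y 0%N w))%:E = 0)%E.
  rewrite /zc; under eq_integral do rewrite EFinB.
  have -> : (\int[P]_w ((z n (Y 0 w))%:E - mu%:E) =
      \int[P]_w (z n (Y 0 w))%:E - \int[P]_w (cst mu%:E w))%E.
    by apply: integralB => //; exact: finite_measure_integrable_cst.
  move: EE; rewrite expectation.unlock => ->.
  by rewrite integral_cst//= probability_setT mule1 subee.
have [mS PS] := iid_chebyshev mY indepY lawY mzc izc2 zc0 n d20 V2.
exists [set w | del / 2 <= `|\sum_(i < n) zc (Y i w)|]; split => //.
  move=> w /= /negP; rewrite -ltNge => /ltW h.
  move: Ez; rewrite EE -EFinD abse_EFin lee_fin => Ez.
  have nE : `|n%:R * mu + q| <= e.
    rewrite (_ : n%:R * mu + q = n%:R * (mu + q / n%:R)); last by field; rewrite gt_eqF.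
    by rewrite normrM (ger0_norm (ltW n0)) mulrC -ler_pdivlMr.
  rewrite (_ : _ + q = \sum_(i < n) zc (Y i w) + (n%:R * mu + q)).
    apply: (le_trans (ler_normD _ _)); lra.
  by rewrite /zc sumrB sumr_const card_ord mulr_natl; ring.
apply: (le_trans PS); rewrite lee_fin mulrCA divff ?gt_eqF// mulr1.
by rewrite ler_pdivrMr// exprn_gt0.
Unshelve. all: by end_near. Qed.

End score.

(** * Posterior mean and maximum likelihood estimator under a uniform expansion *)

Section good_event.
Context {R : realType}.
Variables (p : nat) (J : 'M[R]_p) (lam : R).
Hypothesis lam0 : 0 < lam.
Hypothesis Jlam : forall u, lam * l1 u ^+ 2 <= quadf J u.
Hypothesis Jsym : J^T = J.

Lemma posdef_unitmx : J \in unitmx.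
Proof.
rewrite -row_free_unit -kermx_eq0; apply/rowV0P => v /sub_kermxP vJ.
have := Jlam v; rewrite /quadf vJ mul0mx mxE => h.
have h1 : l1 v ^+ 2 <= 0 by rewrite -(ler_pM2l lam0) mulr0.
have /eqP : l1 v = 0 by apply/eqP; rewrite -sqrf_eq0 eq_le h1 sqr_ge0.
move=> /eqP v0; apply/rowP => i; rewrite mxE; apply/eqP; rewrite -normr_le0 -v0.
exact: le_coord_l1.
Qed.

Lemma l1_mulmx (U : 'rV[R]_p) (A : 'M[R]_p) : l1 (U *m A) <= l1 U * mxsum A.
Proof.
rewrite {1}/l1 /mxsum mulr_sumr; apply: ler_sum => j _; rewrite mxE mulr_sumr.
apply: (le_trans (ler_norm_sum _ _ _)); apply: ler_sum => i _.
by rewrite normrM ler_wpM2r// le_coord_l1.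
Qed.

Variables (Theta : set 'rV[R]_p) (ll Lk prior : 'rV[R]_p -> R) (th0 : 'rV[R]_p) (C1 C2 : R).
Hypothesis openT : open Theta.
Hypothesis ll_concave : concave_on Theta ll.
Hypothesis LkE : forall th, Theta th -> Lk th = expR (ll th).
Hypothesis prior0 : forall th, 0 <= prior th.
Hypothesis prior_borel : rV_borel_on Theta prior.
Hypothesis prior_th0 : 0 < prior th0.
Hypothesis C10 : 0 < C1.
Hypothesis C20 : 0 < C2.
Hypothesis prior_le : forall th, Theta th -> prior th <= C1 * expR (C2 * enorm th).

(** The deterministic core, for one sample. The rescaled posterior mean and the rescaled estimator
    are both compared with the same centre [m]; the two summands of the bound are their distances
    from it. *)
Lemma posterior_mean_mle_close (c kappa W r eta M Bm rn : R) (U thhat : 'rV[R]_p) :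
  let C := C1 / prior th0 * expR (C2 * (Bm + l1 th0)) in
  let F := fun th => \1_Theta th * Lk th * prior th in
  0 < c -> 0 <= W ->
  (forall (g : 'rV[R]_p -> R) (K : R),
     measurable_fun setT (g : rVB p -> R) -> (forall u, `|g u| <= K * expR (- c * l1 u)) ->
     `|Iint g| <= K * W) ->
  kappa * W <= Iint (gauss J) / 2 ->
  (forall (S : set 'rV[R]_p) (h w : 'rV[R]_p -> R),
    concave_on S h -> (forall u, l1 u <= M -> S u) ->
    (forall u, l1 u <= M -> `|h u + 2^-1 * quadf J u| <= eta) ->
    (forall u, S u -> 0 <= w u <= C * expR (lam / 8 * l1 u)) ->
    (forall u, l1 u <= M -> `|w u - 1| <= eta) ->
    forall u, (1 + l1 u) * `|\1_S u * expR (h u) * w u - gauss J u| <=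
       kappa * expR (- c * l1 u)) ->
  0 < r -> r <= M -> eta <= lam * r ^+ 2 / 8 ->
  1 <= rn -> C2 <= rn * (lam / 8) ->
  l1 (U *m invmx J) <= Bm ->
  (forall s, l1 s <= M + Bm ->
     `|ll (rn^-1 *: s + th0) - ll th0 - dotr U s + 2^-1 * quadf J s| <= eta) ->
  (forall th, rn * l1 (th - th0) <= M + Bm ->
     Theta th /\ `|prior th / prior th0 - 1| <= eta) ->
  Theta thhat -> (forall th, Theta th -> ll th <= ll thhat) ->
  [/\ (0 < iint (fun th => (F th)%:E) < +oo)%E,
      (forall j, iint (fun th => (`|th ord0 j| * F th)%:E) < +oo)%E &
      l1 (rn *: ((\row_j (fine (iint (fun th => (th ord0 j * F th)%:E)) /
                 fine (iint (fun th => (F th)%:E)))) - thhat)) <=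
          p%:R * (kappa * W / (Iint (gauss J) / 2)) + r].
Proof.
move=> C F c0 W0 HW kW approx r0 rM etar rn1 C2rn mB grid ball Th hatmax.
have rn0 : 0 < rn by exact: lt_le_trans rn1.
have rnN0 : rn != 0 by rewrite gt_eqF.
have rnV0 : 0 < rn^-1 by rewrite invr_gt0.
pose m := U *m invmx J.
have mJ : m *m J = U by rewrite /m mulmxKV// posdef_unitmx.
have dotU s : dotr U s = bilin J m s by rewrite /dotr /bilin mJ.
pose b := rn^-1 *: m + th0.
have bE u : rn^-1 *: u + b = rn^-1 *: (m + u) + th0.
  by rewrite /b scalerDr addrA [rn^-1 *: u + _]addrC.
pose S := [set u | Theta (rn^-1 *: u + b)].
(* The recentred log-likelihood, with the value at [m] replaced by its approximation
   [ll th0 + m'Jm / 2]. The zero term [dotr 0 u] gives [h] the shape required by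
   [concave_add_affine]. *)
pose h u := ll (rn^-1 *: u + b) + dotr 0 u + (- ll th0 - 2^-1 * bilin J m m).
have hE u : h u + 2^-1 * quadf J u =
    ll (rn^-1 *: (m + u) + th0) - ll th0 - dotr U (m + u) + 2^-1 * quadf J (m + u).
  rewrite dotU /h bE -[quadf J u]/(bilin J u u) -[quadf J (m + u)]/(bilin J (m + u) (m + u)).
  have -> : dotr 0 u = 0 by rewrite /dotr mul0mx mxE.
  rewrite !bilinDl !bilinDr (bilinC u m Jsym); lra.
have ch : concave_on S h by apply: concave_add_affine; exact: concave_affine.
have lmu u : l1 u <= M -> l1 (m + u) <= M + Bm.
  by move=> uM; apply: (le_trans (l1D _ _)); rewrite addrC lerD.
have inball u : l1 u <= M -> rn * l1 (rn^-1 *: u + b - th0) <= M + Bm.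
  move=> uM; rewrite bE addrK l1Z (ger0_norm (ltW rnV0)) mulrA mulfV// mul1r.
  exact: lmu.
have SM u : l1 u <= M -> S u by move=> /inball/ball[].
pose w u := prior (rn^-1 *: u + b) / prior th0.
have hM u : l1 u <= M -> `|h u + 2^-1 * quadf J u| <= eta.
  by move=> uM; rewrite hE; apply: grid; exact: lmu.
have wM u : l1 u <= M -> `|w u - 1| <= eta by move=> /inball/ball[].
(* [C] absorbs the prior bound at the centre, as [rn >= 1] keeps the centre bounded; the remaining
   rate [C2 / rn] is at most [lam / 8]. *)
have wC u : S u -> 0 <= w u <= C * expR (lam / 8 * l1 u).
  move=> Su; rewrite divr_ge0 ?prior0//=.
  rewrite /w ler_pdivrMr//; apply: (le_trans (prior_le Su)).
  rewrite /C (_ : _ / _ * _ * _ * _ = C1 * (expR (C2 * (Bm + l1 th0)) * expR (lam / 8 * l1 u))); last first.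
    by field; rewrite gt_eqF.
  rewrite ler_pM2l// -expRD ler_expR.
  have h1 : enorm (rn^-1 *: u + b) <= rn^-1 * l1 m + rn^-1 * l1 u + l1 th0.
    apply: (le_trans (enorm_le_l1 _)); rewrite bE; apply: (le_trans (l1D _ _)); rewrite lerD2r.
    by rewrite l1Z (ger0_norm (ltW rnV0)) -mulrDr ler_pM2l// l1D.
  have h2 : rn^-1 * l1 m <= Bm.
    apply: le_trans mB; rewrite -/m ler_piMl ?l1_ge0// invf_le1//.
  have h3 : C2 * (rn^-1 * l1 u) <= lam / 8 * l1 u.
    rewrite mulrA ler_wpM2r ?l1_ge0//.
    by rewrite ler_pdivrMr// mulrC.
  have h4 : C2 * enorm (rn^-1 *: u + b) <= C2 * (Bm + rn^-1 * l1 u + l1 th0).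
    rewrite ler_pM2l//; lra.
  lra.
have gapp := approx S h w ch SM hM wC wM.
have mF : measurable_fun setT (F : rVB p -> R).
  (* The indicator is doubled because the log-likelihood and the prior are controlled on [Theta]
     only. *)
  have -> : F = fun th => (\1_Theta th * expR (ll th)) * (\1_Theta th * prior th).
    apply/funext => th; rewrite /F indicE; case: (boolP (th \in Theta)) => [/set_mem Tt|_].
      by rewrite !mul1r LkE.
    by rewrite !mul0r.
  apply: measurable_funM; first exact: measurable_expR_concave.
  exact: measurable_indic_mul.
pose c1 := expR (ll th0 + 2^-1 * bilin J m m) * prior th0.
have c10 : 0 < c1 by rewrite mulr_gt0// expR_gt0.
have Fg u : F (rn^-1 *: (m + u) + th0) = c1 * (\1_S u * expR (h u) * w u).
  rewrite -bE /F /w !indicE.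
  have -> : (rn^-1 *: u + b \in Theta) = (u \in S) by apply/idP/idP => /set_mem H; exact/mem_set.
  case: (boolP (u \in S)) => [/set_mem Su|_]; last by rewrite !mul0r mulr0.
  rewrite !mul1r LkE// /c1.
  have -> : ll (rn^-1 *: u + b) = (ll th0 + 2^-1 * bilin J m m) + h u.
    have -> : h u = ll (rn^-1 *: u + b) - ll th0 - 2^-1 * bilin J m m.
      by rewrite /h /dotr mul0mx mxE; ring.
    by ring.
  by rewrite expRD; field; rewrite gt_eqF.
have [h1 h2 h3] := posterior_mean_close lam0 Jlam c0 W0 HW kW mF c10 rn0 Fg gapp.
split => //.
pose u := rn *: (thhat - th0) - m.
have ub : rn^-1 *: u + b = thhat.
  by apply/rowP => i; rewrite /u /b !mxE; field; rewrite rnN0.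
have Su : S u by rewrite /S /= ub.
have M0 : l1 (0 : 'rV[R]_p) <= M by rewrite l1_0 (le_trans (ltW r0)).
have hu : h 0 <= h u.
  rewrite /h ub; have := hatmax _ (SM _ M0).
  by rewrite /dotr !mul0mx !mxE => ?; rewrite !addr0 lerD2r.
have ur : l1 u <= r.
  apply: (concave_argmax_close lam0 Jlam r0 ch _ _ etar Su hu) => v vr.
    by apply: SM; exact: le_trans vr rM.
  by apply: hM; exact: le_trans vr rM.
set pm := \row_j _; pose V := rn *: (pm - th0) - m.
have -> : rn *: (pm - thhat) = V - u.
  by apply/rowP => i; rewrite /V /u !mxE; ring.
apply: (le_trans (l1B _ _)); apply: lerD => //; apply: l1_le => j.
have VE (x y z : 'rV[R]_p) : (rn *: (x - y) - z) ord0 j = rn * (x ord0 j - y ord0 j) - z ord0 j.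
  by rewrite !mxE.
by rewrite /V VE mxE; exact: h3.
Qed.

End good_event.

(** * Local quadratic expansion of the log-likelihood *)

Section main.
Context {R : realType} {d : measure_display} {Omega : measurableType d}.
Variables (P : probability Omega R) (Y : nat -> Omega -> R) (p : nat)
  (Theta : set 'rV[R]_p) (fm : R -> 'rV[R]_p -> R) (theta0 : 'rV[R]_p) (D : R -> 'rV[R]_p)
  (J : 'M[R]_p) (prior : 'rV[R]_p -> R) (C1 C2 : R) (thetahat : nat -> Omega -> 'rV[R]_p).
Hypothesis mY : forall i, measurable_fun setT (Y i).
Hypothesis indepY : mutually_independent P Y.
Hypothesis lawY : forall i (A : set R), measurable A -> P (Y i @^-1` A) = P (Y 0%N @^-1` A).
Hypothesis openT : open Theta.
Hypothesis fm_gt0 : forall y th, Theta th -> 0 < fm y th.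
Hypothesis mfm : forall th, Theta th -> measurable_fun setT (fun y => fm y th).
Hypothesis fm_concave : forall y, concave_on Theta (fun th => ln (fm y th)).
Hypothesis Theta0 : Theta theta0.
Hypothesis mD : forall j, measurable_fun setT (fun y => D y ord0 j).
Hypothesis D2 : forall j, P.-integrable setT (fun w => ((D (Y 0%N w) ord0 j) ^+ 2)%:E).
Hypothesis ED : forall j, ('E_P[fun w => D (Y 0%N w) ord0 j] = 0)%E.
Hypothesis Jsym : J^T = J.
Hypothesis Jpos : forall t : 'rV[R]_p, t != 0 -> 0 < quadf J t.
Hypothesis ER : forall eps : R, 0 < eps -> exists2 del : R, 0 < del &
     forall t : 'rV[R]_p, enorm t < del -> Theta (theta0 + t) ->
       P.-integrable setT (fun w => (remR fm D theta0 (Y 0%N w) t)%:E) /\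
       (`| 'E_P[fun w => remR fm D theta0 (Y 0%N w) t] + (2^-1 * quadf J t)%:E |
          <= (eps * enorm t ^+ 2)%:E)%E.
Hypothesis VR : forall eps : R, 0 < eps -> exists2 del : R, 0 < del &
     forall t : 'rV[R]_p, enorm t < del -> Theta (theta0 + t) ->
       ('V_P[fun w => remR fm D theta0 (Y 0%N w) t] <= (eps * enorm t ^+ 2)%:E)%E.
Hypothesis mle : wp_tends_to_one P (fun n => [set w | is_mle Theta fm Y n w (thetahat n w)]).
Hypothesis prior_ge0 : forall th, 0 <= prior th.
Hypothesis prior_borel : rV_borel_on Theta prior.
Hypothesis prior_cont : {for theta0, continuous prior}.
Hypothesis prior_theta0 : 0 < prior theta0.
Hypothesis C10 : 0 < C1.
Hypothesis C20 : 0 < C2.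
Hypothesis prior_le : forall th, Theta th -> prior th <= C1 * expR (C2 * enorm th).

Let rt (n : nat) : R := Num.sqrt n%:R.

Let measurable_remR t : Theta (theta0 + t) ->
  measurable_fun setT (fun y => remR fm D theta0 y t).
Proof.
move=> Tt; rewrite /remR; apply: measurable_funB.
  apply: measurable_funB.
    by apply: (measurableT_comp (f := @ln R)); [exact: measurable_ln|exact: mfm].
  by apply: (measurableT_comp (f := @ln R)); [exact: measurable_ln|exact: mfm].
rewrite (_ : (fun y => dotr _ _) = fun y => \sum_j D y ord0 j * t ord0 j); last first.
  by apply/funext => y; rewrite /dotr mxE; apply: eq_bigr => j _; rewrite mxE.
apply: measurable_sum => j; exact: measurable_funM.
Qed.

Let near_Theta : exists2 e : R, 0 < e & forall th, l1 (th - theta0) < e -> Theta th.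
Proof. by apply: nbhs_l1; exact: open_nbhs_nbhs. Qed.

Let whp_remR (v : 'rV[R]_p) (del : R) : 0 < del -> forall b, 0 < b ->
  whp P b (fun n => [set w | `|\sum_(i < n) remR fm D theta0 (Y i w) ((rt n)^-1 *: v)
     + 2^-1 * quadf J v| <= del]).
Proof.
move=> del0 b b0.
apply: (whp_iid_sum mY indepY lawY (z := fun n y => remR fm D theta0 y ((rt n)^-1 *: v)) _ del0 b0).
(* [n] times the squared norm of [v / rt n] is at most [L], so tolerance [e / L] yields [e / n]; the
   added 1 keeps [L] positive at [v = 0]. *)
move=> e e0; pose L := l1 v ^+ 2 + 1.
have L0 : 0 < L by rewrite ltr_wpDl// sqr_ge0.
have eL : 0 < e / L by rewrite divr_gt0.
have [d1 d10 H1] := ER eL; have [d2 d20 H2] := VR eL; have [d3 d30 H3] := near_Theta.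
near=> n.
have rn0 : 0 < rt n by near: n; exact: near_sqrt_gt.
have rnV0 : 0 <= (rt n)^-1 by rewrite invr_ge0 ltW.
have n0 : 0 < n%:R :> R by rewrite -sqrtr_gt0.
have rn2 : rt n ^+ 2 = n%:R by rewrite sqr_sqrtr ?ler0n.
have small (x : R) : 0 < x -> l1 v / x < rt n -> l1 ((rt n)^-1 *: v) < x.
  move=> x0; rewrite l1Z (ger0_norm rnV0) ltr_pdivrMr// => h.
  by rewrite ltr_pdivrMl// mulrC [X in _ < X]mulrC.
have s1 : l1 ((rt n)^-1 *: v) < d1 by apply: small => //; near: n; exact: near_sqrt_gt.
have s2 : l1 ((rt n)^-1 *: v) < d2 by apply: small => //; near: n; exact: near_sqrt_gt.
have s3 : l1 ((rt n)^-1 *: v) < d3 by apply: small => //; near: n; exact: near_sqrt_gt.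
have Tt : Theta (theta0 + (rt n)^-1 *: v) by apply: H3; rewrite addrC addKr.
have en2 : e / L * enorm ((rt n)^-1 *: v) ^+ 2 <= e / n%:R.
  have h : enorm ((rt n)^-1 *: v) ^+ 2 <= L / n%:R.
    apply: (@le_trans _ _ (l1 ((rt n)^-1 *: v) ^+ 2)).
      by rewrite ler_sqr ?nnegrE ?enorm_ge0 ?l1_ge0// enorm_le_l1.
    rewrite l1Z (ger0_norm rnV0) exprMn exprVn rn2 mulrC ler_pM2r ?invr_gt0// lerDl//.
  apply: (le_trans (ler_wpM2l (ltW eL) h)).
  by rewrite mulrA divfK ?gt_eqF.
have [i1 e1] := H1 _ (le_lt_trans (enorm_le_l1 _) s1) Tt.
split => //.
- exact: measurable_remR.
- have -> : 2^-1 * quadf J v / n%:R = 2^-1 * quadf J ((rt n)^-1 *: v).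
    by rewrite quadfZ exprVn rn2 [n%:R^-1 * _]mulrC mulrA.
  by apply: (le_trans e1); rewrite lee_fin.
- by apply: (le_trans (H2 _ (le_lt_trans (enorm_le_l1 _) s2) Tt)); rewrite lee_fin.
Unshelve. all: by end_near. Qed.

Let score n w : 'rV[R]_p := \row_j ((rt n)^-1 * \sum_(i < n) D (Y i w) ord0 j).

Let whp_score b : 0 < b -> exists2 B : R, 0 <= B &
  whp P b (fun n => [set w | l1 (score n w) <= B]).
Proof.
move=> b0; have b1 : 0 < b / p.+1%:R by rewrite divr_gt0.
have hB (j : 'I_p) : exists B : R, 0 < B /\
    whp P (b / p.+1%:R) (fun n => [set w | `|(rt n)^-1 * \sum_(i < n) D (Y i w) ord0 j| <= B]).
  have E0 : (\int[P]_w (D (Y 0%N w) ord0 j)%:E = 0)%E by have := ED j; rewrite expectation.unlock.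
  by have [B B0 H] := whp_score_bounded mY indepY lawY (mD j) (D2 j) E0 b1; exists B.
have [B HB] := choice hB.
exists (\sum_j B j); first by apply: sumr_ge0 => j _; rewrite ltW// (HB j).1.
have := whp_all (s := enum 'I_p) (fun j _ => (HB j).2).
apply: whpW.
  rewrite size_enum_ord mulrCA ger_pMr// ler_pdivrMr// mul1r ler_nat//.
apply: filterE => n w /= H; apply: ler_sum => j _; rewrite mxE.
by apply: H; rewrite mem_enum.
Qed.

(** Up to an affine term the summed remainder is the log-likelihood, hence concave in [s], as
    [grid_uniform] requires. *)
Let sum_remR n w s : 0 < rt n ->
  \sum_(i < n) remR fm D theta0 (Y i w) ((rt n)^-1 *: s) =
  loglik fm Y n w ((rt n)^-1 *: s + theta0) - loglik fm Y n w theta0 - dotr (score n w) s.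
Proof.
move=> rn0; rewrite /loglik -!sumrB.
rewrite /remR [LHS]sumrB; congr (_ - _).
  by apply: eq_bigr => i _; rewrite [theta0 + _]addrC.
under eq_bigr do rewrite /dotr mxE.
rewrite /dotr mxE exchange_big /=; apply: eq_bigr => j _.
rewrite !mxE mulr_sumr mulr_suml; apply: eq_bigr => i _.
by ring.
Qed.

(** Each of the three events (bounded score, expansion on the grid, [thetahat] a maximiser) may fail
    with probability [del / 3]. The score bound comes first, since the constant [C] and the radius
    of the grid depend on it. *)
Lemma whp_posterior (eps del : R) : 0 < eps -> 0 < del ->
  whp P del (fun n => [set w | post_well_defined Theta fm prior Y n w /\
    enorm (Num.sqrt (n%:R) *: (post_mean Theta fm prior Y n w - thetahat n w)) <= eps]).
Proof.
move=> eps0 del0.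
have [lam lam0 Jlam] := quadf_coercive Jpos.
have d30 : 0 < del / 3 by rewrite divr_gt0.
have [B B0 whpU] := whp_score d30.
pose Bm := B * mxsum (invmx J).
have Bm0 : 0 <= Bm by rewrite mulr_ge0// mxsum_ge0.
pose c := lam / 16; have c0 : 0 < c by rewrite divr_gt0.
have [W W0 HW] := @Iint_bound R p c c0.
have IG0 := Iint_gauss_gt0 lam0 Jlam.
(* [rho <= 1] keeps at least half the Gaussian mass, and [p * rho <= eps / 2] leaves the other half
   of [eps] to the estimator. *)
pose rho := Num.min 1 (eps / (2 * p.+1%:R)).
have p10 : 0 < 2 * p.+1%:R :> R by rewrite mulr_gt0.
have rho0 : 0 < rho by rewrite lt_min ltr01 divr_gt0.
pose kappa := rho * (Iint (gauss J) / 2) / (W + 1).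
have W10 : 0 < W + 1 by rewrite ltr_wpDl.
have IG20 : 0 < Iint (gauss J) / 2 by rewrite divr_gt0.
have kappa0 : 0 < kappa by rewrite !divr_gt0// mulr_gt0.
have kW : kappa * W <= rho * (Iint (gauss J) / 2).
  rewrite /kappa mulrAC ler_pdivrMr// ler_pM2l ?mulr_gt0//; lra.
have kW1 : kappa * W <= Iint (gauss J) / 2.
  apply: (le_trans kW); rewrite ger_pMl// ge_min lexx//.
have prho : p%:R * (kappa * W / (Iint (gauss J) / 2)) <= eps / 2.
  apply: (@le_trans _ _ (p%:R * rho)).
    by rewrite ler_wpM2l// ler_pdivrMr.
  apply: (@le_trans _ _ (p.+1%:R * (eps / (2 * p.+1%:R)))).
    rewrite ler_pM ?(ltW rho0)// ?ler_nat// ge_min lexx orbT//.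
  have e2 (x : R) : x != 0 -> x * (eps / (2 * x)) = eps / 2 by move=> x0; field.
  by rewrite e2// pnatr_eq0.
pose r := eps / 2; have r0 : 0 < r by rewrite divr_gt0.
pose C := C1 / prior theta0 * expR (C2 * (Bm + l1 theta0)).
have C0 : 0 <= C by rewrite mulr_ge0 ?expR_ge0// divr_ge0 ?ltW.
have [M1 [eta1 [M11 eta10 approx]]] := concave_gauss_approx lam0 Jlam C0 kappa0.
pose M := M1 + r; pose eta := Num.min eta1 (lam * r ^+ 2 / 8).
have eta0 : 0 < eta by rewrite lt_min eta10 divr_gt0// mulr_gt0// exprn_gt0.
have etaeta1 : eta <= eta1 by rewrite ge_min lexx.
have etar : eta <= lam * r ^+ 2 / 8 by rewrite ge_min lexx orbT.
have M1M : M1 <= M by rewrite lerDl ltW.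
have rM : r <= M by rewrite lerDr (le_trans ler01).
have MB0 : 0 <= M + Bm by rewrite addr_ge0// addr_ge0 ?ltW// (lt_le_trans ltr01).
(* The radius [M + Bm] covers every [s = m + u] with [u] in the ball of radius [M] and [m] bounded
   by [Bm]. *)
have [F [dl [M2 [dl0 MM2 FM2 grid]]]] := grid_uniform J MB0 eta0.
have f0 : 0 < del / 3 / (size F).+1%:R by rewrite divr_gt0.
have whpF := whp_all (s := F) (fun v _ => whp_remR v dl0 f0).
have whpM : whp P (del / 3) (fun n => [set w | is_mle Theta fm Y n w (thetahat n w)]).
  by apply: (wp_tends_to_oneP P _).1.
have := whpI whpU (whpI whpF whpM).
apply: whpW.
  have hF : (size F)%:R * (del / 3 / (size F).+1%:R) <= del / 3.
    by rewrite mulrCA ger_pMr// ler_pdivrMr// mul1r ler_nat.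
  apply: (le_trans (lerD (lexx _) (lerD hF (lexx _)))); lra.
have [e3 e30 HT] := near_Theta.
have [e4 e40 Hpi] : exists2 e : R, 0 < e & forall th, l1 (th - theta0) < e ->
    `|prior th / prior theta0 - 1| <= eta.
  apply: nbhs_l1.
  have ep : 0 < eta * prior theta0 by rewrite mulr_gt0.
  have /cvgrPdist_le/(_ _ ep) := prior_cont.
  apply: filterS => th h.
  rewrite (_ : _ - 1 = (prior th - prior theta0) / prior theta0); last by field; rewrite gt_eqF.
  by rewrite normrM normfV (gtr0_norm prior_theta0) ler_pdivrMr// distrC.
near=> n.
have rn1 : 1 <= rt n by apply: ltW; near: n; exact: near_sqrt_gt.
have rn0 : 0 < rt n by exact: lt_le_trans rn1.
have rnV0 : 0 <= (rt n)^-1 by rewrite invr_ge0 ltW.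
have C2rn : C2 <= rt n * (lam / 8).
  rewrite -ler_pdivrMr ?divr_gt0//; apply: ltW; near: n; exact: near_sqrt_gt.
have M2e3 : M2 < rt n * e3.
  by rewrite -ltr_pdivrMr//; near: n; exact: near_sqrt_gt.
have M2e4 : M2 < rt n * e4.
  by rewrite -ltr_pdivrMr//; near: n; exact: near_sqrt_gt.
have ball th : rt n * l1 (th - theta0) <= M + Bm ->
    Theta th /\ `|prior th / prior theta0 - 1| <= eta.
  move=> h; have h2 := le_trans h MM2; split; [apply: HT|apply: Hpi].
    by rewrite -(ltr_pM2l rn0) (le_lt_trans h2).
  by rewrite -(ltr_pM2l rn0) (le_lt_trans h2).
move=> w [/= Uw [/= Fw [hatT hatmax]]].
have ll_concave : concave_on Theta (loglik fm Y n w).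
  by apply: (concave_sum (k := fun i th => ln (fm (Y i w) th))) => i; exact: fm_concave.
have LkE th : Theta th -> lik fm Y n w th = expR (loglik fm Y n w th).
  by move=> Tt; rewrite /lik /loglik expR_sum; apply: eq_bigr => i _; rewrite lnK// posrE fm_gt0.
have mBm : l1 (score n w *m invmx J) <= Bm.
  by apply: (le_trans (l1_mulmx _ _)); rewrite ler_wpM2r ?mxsum_ge0.
have gridw s : l1 s <= M + Bm -> `|loglik fm Y n w ((rt n)^-1 *: s + theta0) -
   loglik fm Y n w theta0 - dotr (score n w) s + 2^-1 * quadf J s| <= eta.
  pose k s := loglik fm Y n w ((rt n)^-1 *: s + theta0) + dotr (- score n w) s
     + (- loglik fm Y n w theta0).
  have kE t : k t = loglik fm Y n w ((rt n)^-1 *: t + theta0) -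
      loglik fm Y n w theta0 - dotr (score n w) t.
    by rewrite /k /dotr mulNmx mxE; ring.
  rewrite -kE; apply: (grid [set s | Theta ((rt n)^-1 *: s + theta0)] k).
  - move=> t tM2 /=; apply: HT; rewrite addrK l1Z (ger0_norm rnV0) ltr_pdivrMl//.
    exact: le_lt_trans M2e3.
  - by apply: concave_add_affine; exact: concave_affine.
  - by move=> v vF; rewrite kE -sum_remR//; exact: Fw.
have approx' (S : set 'rV[R]_p) (h w' : 'rV[R]_p -> R) :
    concave_on S h -> (forall u, l1 u <= M -> S u) ->
    (forall u, l1 u <= M -> `|h u + 2^-1 * quadf J u| <= eta) ->
    (forall u, S u -> 0 <= w' u <= C * expR (lam / 8 * l1 u)) ->
    (forall u, l1 u <= M -> `|w' u - 1| <= eta) ->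
    forall u, (1 + l1 u) * `|\1_S u * expR (h u) * w' u - gauss J u| <=
       kappa * expR (- c * l1 u).
  move=> a1 a2 a3 a4 a5; apply: approx => // u uM.
  - by apply: a2; exact: le_trans uM M1M.
  - by apply: le_trans etaeta1; apply: a3; exact: le_trans uM M1M.
  - by apply: le_trans etaeta1; apply: a5; exact: le_trans uM M1M.
have [h1 h2 h3] := posterior_mean_mle_close lam0 Jlam Jsym openT ll_concave LkE prior_ge0
  prior_borel prior_theta0 C10 C20 prior_le c0 W0 HW kW1 approx' r0 rM etar rn1 C2rn mBm
  gridw ball hatT hatmax.
split; first by split.
apply: (le_trans (enorm_le_l1 _)); apply: (le_trans h3); rewrite /r; lra.
Unshelve. all: by end_near. Qed.

End main.

Theorem theorem4p2
  (R : realType) (d : measure_display) (Omega : measurableType d)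
  (P : probability Omega R) (Y : nat -> Omega -> R) (f : R -> R)
  (p : nat) (Theta : set 'rV[R]_p) (fm : R -> 'rV[R]_p -> R)
  (theta0 : 'rV[R]_p) (D : R -> 'rV[R]_p) (J : 'M[R]_p)
  (prior : 'rV[R]_p -> R) (C1 C2 : R)
  (thetahat : nat -> Omega -> 'rV[R]_p) :
  (* Y_1, Y_2, ... i.i.d. with continuous (Lebesgue) density f *)
  (forall i, measurable_fun setT (Y i)) ->
  mutually_independent P Y ->
  continuous f -> (forall y, 0 <= f y) ->
  (forall i (A : set R), measurable A ->
     P (Y i @^-1` A) = (\int[@lebesgue_measure R]_(y in A) (f y)%:E)%E) ->
  (* the parametric model: Theta open and convex, f(., theta) densities *)
  open Theta -> convex_setR Theta ->
  (forall y th, Theta th -> 0 < fm y th) ->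
  (forall th, Theta th -> measurable_fun setT (fun y => fm y th)) ->
  (forall th, Theta th ->
     (\int[@lebesgue_measure R]_y (fm y th)%:E)%E = 1%E) ->
  (* log f(y, theta) concave in theta *)
  (forall y, concave_on Theta (fun th => ln (fm y th))) ->
  (* theta |-> E log f(Y, theta) has a unique global maximum at theta0 *)
  Theta theta0 ->
  (forall th, Theta th -> th != theta0 ->
     ('E_P[fun w => ln (fm (Y 0%N w) th)] < 'E_P[fun w => ln (fm (Y 0%N w) theta0)])%E) ->
  (* D(Y) has mean zero and finite covariance matrix *)
  (forall j, measurable_fun setT (fun y => D y ord0 j)) ->
  (forall j, P.-integrable setT (fun w => ((D (Y 0%N w) ord0 j) ^+ 2)%:E)) ->
  (forall j, ('E_P[fun w => D (Y 0%N w) ord0 j] = 0)%E) ->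
  (* J symmetric positive definite *)
  J^T = J -> (forall t : 'rV[R]_p, t != 0 -> 0 < quadf J t) ->
  (* E R(Y,t) = -1/2 t'Jt + o(|t|^2),  where
     R(y,t) = log f(y,theta0+t) - log f(y,theta0) - D(y)'t *)
  (forall eps : R, 0 < eps -> exists2 del : R, 0 < del &
     forall t : 'rV[R]_p, enorm t < del -> Theta (theta0 + t) ->
       P.-integrable setT (fun w => (remR fm D theta0 (Y 0%N w) t)%:E) /\
       (`| 'E_P[fun w => remR fm D theta0 (Y 0%N w) t] + (2^-1 * quadf J t)%:E |
          <= (eps * enorm t ^+ 2)%:E)%E) ->
  (* Var R(Y,t) = o(|t|^2) *)
  (forall eps : R, 0 < eps -> exists2 del : R, 0 < del &
     forall t : 'rV[R]_p, enorm t < del -> Theta (theta0 + t) ->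
       ('V_P[fun w => remR fm D theta0 (Y 0%N w) t] <= (eps * enorm t ^+ 2)%:E)%E) ->
  (* thetahat_n is the MLE (with probability tending to one) *)
  wp_tends_to_one P (fun n => [set w | is_mle Theta fm Y n w (thetahat n w)]) ->
  (* the (possibly improper) prior density pi *)
  (forall th, 0 <= prior th) -> rV_borel_on Theta prior ->
  {for theta0, continuous prior} -> 0 < prior theta0 ->
  0 < C1 -> 0 < C2 ->
  (forall th, Theta th -> prior th <= C1 * expR (C2 * enorm th)) ->
  (* conclusion: the posterior mean is well defined with probability tending
     to one, and sqrt n (theta_n^* - thetahat_n) -> 0 in probability *)
  wp_tends_to_one P (fun n => [set w | post_well_defined Theta fm prior Y n w]) /\
  cvg_in_prob0 P (fun n w =>
    Num.sqrt (n%:R) *: (post_mean Theta fm prior Y n w - thetahat n w)).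
Proof.
move=> mY indepY _ _ dens openT _ fm0 mfm _ fmc T0 _ mD D2 ED Js Jpos ER VR mle pi0 pib pic pi00 C10 C20 pile.
have lawY i (A : set R) : measurable A -> P (Y i @^-1` A) = P (Y 0%N @^-1` A).
  by move=> mA; rewrite !dens.
have main := whp_posterior mY indepY lawY openT fm0 mfm fmc T0 mD D2 ED Js Jpos ER VR mle
  pi0 pib pic pi00 C10 C20 pile.
split.
  (* Well-definedness does not involve the precision, so any [eps] will do; here it is 1. *)
  apply/wp_tends_to_oneP => b b0; apply: whpW (main _ _ ltr01 b0) => //.
  by apply: filterE => n w [].
move=> eps del eps0 del0; move: (main _ _ eps0 del0); apply: filterS => n [B [mB BE PB]].
exists B; split => // w /= hw; apply: contrapT => /BE[_]; rewrite leNgt hw//.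
Qed.
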